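(* Let $d\ge 2$ and let $(\rho,v)$ be a smooth solution on $\mathbb{R}^d$ of the stationary barotropic compressible Navier–Stokes system $$\nabla\cdot(\rho v)=0,\qquad \nabla\cdot(\rho v\otimes v)=-\nabla P+\mu\Delta v+(\mu+\lambda)\nabla(\nabla\cdot v),\qquad P=A\rho^\gamma ,$$ satisfying $$\|\rho\|_{L^\infty(\mathbb{R}^d)}+\|v\|_{L^{\frac{d}{d-1}}(\mathbb{R}^d)}+\|v\|_{L^{\frac{3d}{d-1}}(\mathbb{R}^d)}<\infty .$$ Then $v\equiv 0$ and $\rho$ is constant on $\mathbb{R}^d$.
   Context: $\rho:\mathbb{R}^d\to[0,\infty)$ is the density, $v:\mathbb{R}^d\to\mathbb{R}^d$ the velocity, $P$ the pressure. The constants satisfy $\mu>0$, $\lambda+2\mu>0$, $A>0$, $\gamma>1$. $(\nabla\cdot(\rho v\otimes v))_j=\sum_i\partial_i(\rho v_iv_j)$. *)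

(* Defs.v *)
From HB Require Import structures.
From mathcomp Require Import all_boot all_order all_algebra.
From mathcomp Require Import all_classical all_reals all_analysis.
Set Implicit Arguments. Unset Strict Implicit. Unset Printing Implicit Defensive.
Import Order.TTheory GRing.Theory Num.Theory.
Import numFieldNormedType.Exports.
Local Open Scope classical_set_scope.
Local Open Scope ring_scope.

Section Defs.
Variable R : realType.

Definition partial (d : nat) (i : 'I_d) (f : 'rV[R]_d -> R) : 'rV[R]_d -> R :=
  fun x => derive f x (delta_mx 0 i).

Fixpoint partials (d : nat) (s : seq 'I_d) (f : 'rV[R]_d -> R) : 'rV[R]_d -> R :=
  match s with
  | [::] => f
  | i :: s' => partial i (partials s' f)
  end.

Definition smooth (d : nat) (f : 'rV[R]_d -> R) : Prop :=
  forall (s : seq 'I_d) (x : 'rV[R]_d), differentiable (partials s f) x.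

Definition vcomp (d : nat) (v : 'rV[R]_d -> 'rV[R]_d) (j : 'I_d) : 'rV[R]_d -> R :=
  fun x => v x ord0 j.

Definition enorm (d : nat) (u : 'rV[R]_d) : R :=
  Num.sqrt (\sum_(j < d) u ord0 j ^+ 2).

(* iterated Lebesgue integral over R^n (of a nonnegative function of the
   coordinates y 0, ..., y (n-1)); by Tonelli this is the Lebesgue integral on
   R^n for nonnegative measurable (here: continuous) integrands *)
Fixpoint iter_integral (n : nat) (F : (nat -> R) -> \bar R) : \bar R :=
  match n with
  | 0 => F (fun _ => 0)
  | n'.+1 => (\int[@lebesgue_measure R]_(t in [set: R])
               iter_integral n' (fun y => F (fun k => if k is k'.+1 then y k' else t)))%E
  end.

Definition Rd_integral (d : nat) (g : 'rV[R]_d -> \bar R) : \bar R :=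
  iter_integral d (fun y => g (\row_(i < d) y (nat_of_ord i))).

Definition Lp_finite (d : nat) (p : R) (f : 'rV[R]_d -> 'rV[R]_d) : Prop :=
  (Rd_integral (fun x => ((enorm (f x)) `^ p)%:E) < +oo)%E.

(* L^infinity bound (for continuous functions ess sup = sup) *)
Definition Linf_bounded (d : nat) (f : 'rV[R]_d -> R) : Prop :=
  exists M : R, forall x, `|f x| <= M.

End Defs.

(* Main.v *)
(** Testing the momentum equation with [v] gives a pointwise identity
    [div F = - Q]: the pressure work is itself a divergence, since
    [v . grad P = gamma / (gamma - 1) * div (P v)] by continuity, and
    [Q >= k |grad v|^2] once [mu + lambda = a - b] with [0 <= b < mu] and the
    [b]-part of [grad (div v)] is integrated by parts in the other order.
    Multiplying by a cutoff [phi_r] of the cube of side [r] with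
    [|grad phi_r| <= (4 / r) sqrt phi_r] and absorbing the term [|v| |grad v|]
    of [F], it remains to estimate [(|v| + |v|^3) / r] on the annulus where
    [grad phi_r <> 0].  Young's inequality bounds it by
    [C_eta (|v|^p + |v|^(3p)) + eta r^-d] with [p = d / (d - 1)], whose integral
    over the annulus is at most a tail of a convergent integral plus a multiple
    of [eta].  Hence [grad v = 0], so [v = 0] by integrability, then
    [grad P = 0]. *)
Require Import Defs.
From HB Require Import structures.
From mathcomp Require Import all_boot all_order all_algebra.
From mathcomp Require Import all_classical all_reals all_analysis.
From mathcomp Require Import ring lra.
Set Implicit Arguments. Unset Strict Implicit. Unset Printing Implicit Defensive.
Import Order.TTheory GRing.Theory Num.Theory.
Import numFieldNormedType.Exports.
Local Open Scope classical_set_scope.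
Local Open Scope ring_scope.

(** The exponent p = d / (d - 1) is dictated by scaling: it is conjugate to d, so the error in
    Young's inequality is a multiple of r^-d, and the volume of the annulus, of order r^d, cancels
    it exactly. The two integrability hypotheses match the two growth rates of the flux: |v| comes
    from the pressure and |v|^3 from the kinetic energy. The viscous term, once absorbed, leaves
    |v|^2 / r^2, which for r >= 1 lies below (|v| + |v|^3) / r.

    The obstacle is the integral, which is iterated one coordinate at a time and takes extended real
    values. Computations are therefore made with continuous functions vanishing off a cube. There
    the iterated integral is a real number, linear, positive and translation invariant by induction
    on the dimension, and translation invariance yields the divergence theorem. The hypotheses on v
    enter the estimate through a one-sided comparison: a cutoff times |v|^p is at most |v|^p. *)

(** * Integrals over the line of continuous functions with bounded support *)

Section line_integral.
Variable R : realType.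
Local Notation leb := (@lebesgue_measure R).
Implicit Types (f g : R -> R) (K M : R).

Definition vanishes_off K f := forall t, K < `|t| -> f t = 0.

Lemma compact_support_restrict K f :
  vanishes_off K f -> ((EFin \o f) \_ (`[(- K)%R, K]%classic))%E = EFin \o f.
Proof.
move=> f0; apply/funext => t; rewrite /patch; case: ifPn => //.
rewrite notin_setE /= in_itv /= => tK; rewrite f0 //.
by rewrite ltNge ler_norml; apply/negP.
Qed.

Lemma compact_support_integrable K f :
  continuous f -> vanishes_off K f -> leb.-integrable setT (EFin \o f).
Proof.
move=> cf f0; rewrite -(compact_support_restrict f0).
refine (iffLR (@integrable_mkcond _ _ R leb _ (EFin \o f) (measurable_itv _)) _).
apply: continuous_compact_integrable; first exact: segment_compact.
exact: continuous_subspaceT.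
Qed.

Lemma integral_line_bound K M f : 0 <= K -> continuous f -> vanishes_off K f ->
  (forall t, `|f t| <= M) -> `|\int[leb]_t f t| <= M * (K *+ 2).
Proof.
move=> K0 cf f0 fM.
have iT := compact_support_integrable cf f0.
have iK : leb.-integrable `[- K, K]%classic (EFin \o f).
  by apply: integrableS iT => //.
have -> : \int[leb]_t f t = \int[leb]_(t in `[- K, K]%classic) f t.
  rewrite [RHS]Rintegral_mkcond; congr fine; apply: eq_integral => t _.
  have := congr1 (fun h => h t) (compact_support_restrict f0).
  by rewrite /patch /=; case: ifP.
apply: le_trans (le_normr_Rintegral _ iK) _ => //.
have -> : M * (K *+ 2) = \int[leb]_(t in `[- K, K]%classic) M.
  rewrite Rintegral_cst // [X in fine X]lebesgue_measure_itv /= lte_fin.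
  case: ltP => [_|KK]; first by rewrite -EFinD /= opprK mulr2n.
  by have -> : K = 0; [lra|rewrite mul0rn mulr0].
apply: le_Rintegral => //.
- have -> : EFin \o (fun t => `|f t|) = abse \o (EFin \o f) by [].
  exact: integrable_abse.
- by apply: continuous_compact_integrable;
    [exact: segment_compact | move=> ?; exact: cvg_cst].
Qed.

Lemma integral_line_gt0 K f t0 : continuous f -> vanishes_off K f ->
  (forall t, 0 <= f t) -> 0 < f t0 -> 0 < \int[leb]_t f t.
Proof.
move=> cf f0 fge0 ft0.
have iT := compact_support_integrable cf f0.
have /cvgrPdist_lt/(_ (f t0 / 2)) := cf t0.
rewrite divr_gt0 // => /(_ isT) /nbhs_ballP[e /= e0 fe].
have le s : t0 - e / 2 <= s <= t0 + e / 2 -> f t0 / 2 <= f s.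
  move=> h; have /fe : ball t0 e s.
    by rewrite /ball /= ltr_norml; lra.
  by rewrite /= ltr_norml; lra.
have mA : measurable (`[t0 - e / 2, t0 + e / 2]%classic : set R).
  exact: measurable_itv.
apply: (@lt_le_trans _ _
  (\int[leb]_(t in `[t0 - e / 2, t0 + e / 2]%classic) (f t0 / 2))).
  rewrite Rintegral_cst // [X in fine X]lebesgue_measure_itv /= lte_fin.
  rewrite ifT; last by lra.
  by rewrite -EFinD /=; apply: mulr_gt0; lra.
rewrite Rintegral_mkcond; apply: le_Rintegral => //.
- have -> : EFin \o (fun=> f t0 / 2) \_ `[t0 - e / 2, t0 + e / 2]
          = ((EFin \o (fun=> (f t0 / 2)%R)) \_ `[(t0 - e / 2)%R, (t0 + e / 2)%R])%E.
    by apply/funext => t; rewrite /patch /=; case: ifP.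
  apply/(integrable_mkcond (EFin \o _)) => //.
  apply: continuous_compact_integrable; first exact: segment_compact.
  by move=> ?; exact: cvg_cst.
- move=> t _; rewrite /patch; case: ifPn => // /set_mem /=.
  by rewrite in_itv /= => /le.
Qed.

(** The substitution rule is applied to nonnegative integrands, so [f] is split into its positive
    and negative parts, both continuous. *)
Lemma integral_line_translate K f (h : R) : continuous f -> vanishes_off K f ->
  \int[leb]_t f (t + h) = \int[leb]_t f t.
Proof.
have dsh x : is_derive x (1 : R) (fun t : R => t + h) 1.
  by apply: is_derive_eq; rewrite addr0.
have csh : continuous (fun t : R => t + h).
  by move=> x; apply: cvgD; [exact: cvg_id|exact: cvg_cst].
have pos g : continuous g -> (forall t, 0 <= g t) ->
    (\int[leb]_t (g t)%:E = \int[leb]_t (g (t + h))%:E)%E.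
  move=> cg g0.
  have D1 : (fun t : R => t + h)^`()%classic = cst 1.
    by apply/funext => t; rewrite derive1E derive_val.
  rewrite (@increasing_ge0_integration_by_substitutionT _ (fun t => t + h)) //.
  - by apply: eq_integral => t _; rewrite D1 /= mulr1.
  - by move=> x y xy; rewrite ltrD2r.
  - by rewrite D1 => x; exact: cvg_cst.
  - by rewrite D1; exact: is_cvg_cst.
  - by rewrite D1; exact: is_cvg_cst.
  - apply/cvgrNyPle => A; near=> x; rewrite -lerBrDr; near: x.
    by apply: nbhs_ninfty_le; rewrite num_real.
  - apply/cvgryPge => A; near=> x; rewrite -lerBlDr; near: x.
    by apply: nbhs_pinfty_ge; rewrite num_real.
move=> cf f0.
rewrite /Rintegral; congr fine.
have cp : continuous (fun t => Num.max (f t) 0).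
  by move=> x; apply: (@continuous_max _ _ f (cst 0)); [exact: cf|exact: cvg_cst].
have cn : continuous (fun t => Num.max (- f t) 0).
  move=> x; apply: (@continuous_max _ _ (fun t => - f t) (cst 0)); last exact: cvg_cst.
  by apply: continuousN; exact: cf.
rewrite integralE [RHS]integralE; congr (_ - _)%E.
- transitivity (\int[leb]_t (Num.max (f (t + h)) 0)%:E)%E.
    by apply: eq_integral => t _; rewrite funeposE EFin_max.
  rewrite -(pos _ cp); last by move=> t; rewrite le_max lexx orbT.
  by apply: eq_integral => t _; rewrite funeposE EFin_max.
- transitivity (\int[leb]_t (Num.max (- f (t + h)) 0)%:E)%E.
    by apply: eq_integral => t _; rewrite funenegE EFin_max.
  rewrite -(pos _ cn); last by move=> t; rewrite le_max lexx orbT.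
  by apply: eq_integral => t _; rewrite funenegE EFin_max.
Unshelve. all: by end_near. Qed.

(* No measurability is needed: the integral of a nonnegative function is a
   supremum over simple functions. *)
Lemma ge0_le_integral_nomeas (f g : R -> \bar R) :
  (forall t, 0 <= f t)%E -> (forall t, f t <= g t)%E ->
  (\int[leb]_t f t <= \int[leb]_t g t)%E.
Proof.
move=> f0 fg; have g0 t : (0 <= g t)%E by apply: le_trans (fg t).
rewrite !ge0_integralTE //; apply: le_ereal_sup => _ [h /= hf <-].
by exists h => //= t; apply: le_trans (fg t).
Qed.

End line_integral.

(** * Iterated integrals in finitely many coordinates *)

Section iterated_integral.
Variable R : realType.
Local Notation leb := (@lebesgue_measure R).
Implicit Types (F G : (nat -> R) -> R) (y z : nat -> R) (K M t h : R).

(** The same match as in [iter_integral], so that slices of the real and the extended iterated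
    integral agree by conversion. *)
Definition scons t y : nat -> R := fun k => if k is k'.+1 then y k' else t.

Fixpoint iter_Rintegral n F : R :=
  match n with
  | 0 => F (fun=> 0)
  | n'.+1 => \int[leb]_t iter_Rintegral n' (fun y => F (scons t y))
  end.

(* Uniform continuity, unlike plain continuity, passes to the partially
   integrated function without any compactness argument. *)
Definition cc_seqfun n K F :=
  (forall y k, (k < n)%N -> K < `|y k| -> F y = 0) /\
  forall e, 0 < e -> exists2 d, 0 < d & forall y z,
    (forall k, (k < n)%N -> `|y k - z k| <= d) -> `|F y - F z| <= e.

Lemma cc_slice n K F t : cc_seqfun n.+1 K F ->
  cc_seqfun n K (fun y => F (scons t y)).
Proof.
move=> [F0 Fu]; split=> [y k kn Ky|e /Fu[d d0 Fd]].
  by apply: (F0 _ k.+1).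
by exists d => // y z yz; apply: Fd => -[|k] kn /=; [rewrite subrr normr0 ltW|exact: yz].
Qed.

Lemma ccD n K F G : cc_seqfun n K F -> cc_seqfun n K G ->
  cc_seqfun n K (fun y => F y + G y).
Proof.
move=> [F0 Fu] [G0 Gu]; split=> [y k kn Ky|e e0].
  by rewrite (F0 _ k) // (G0 _ k) // addr0.
have e2 : 0 < e / 2 by rewrite divr_gt0.
have [d d0 Fd] := Fu _ e2; have [d' d0' Gd] := Gu _ e2.
exists (Num.min d d'); first by rewrite lt_min d0.
move=> y z yz; have -> : F y + G y - (F z + G z) = (F y - F z) + (G y - G z) by ring.
rewrite (le_trans (ler_normD _ _)) // [e]splitr lerD //.
- by apply: Fd => k kn; apply: le_trans (yz k kn) _; rewrite ge_min lexx.
- by apply: Gd => k kn; apply: le_trans (yz k kn) _; rewrite ge_min lexx orbT.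
Qed.

Lemma ccZ n K c F : cc_seqfun n K F -> cc_seqfun n K (fun y => c * F y).
Proof.
move=> [F0 Fu]; split=> [y k kn Ky|e e0].
  by rewrite (F0 _ k) // mulr0.
have c1 : 0 < `|c| + 1 by rewrite ltr_wpDl.
have [d d0 Fd] := Fu (e / (`|c| + 1)) (divr_gt0 e0 c1).
exists d => // y z /Fd; rewrite -mulrBr normrM ler_pdivlMr // => h.
apply: le_trans h; rewrite mulrC ler_wpM2l // lerDl //.
Qed.

(** Linearity and the volume bound are predicates of [n] because they are proved by one simultaneous
    induction: integrating a slice once more requires its continuity, which uses both properties one
    dimension lower. *)
Definition linear_on_cc n := forall K F G c, 0 <= K ->
  cc_seqfun n K F -> cc_seqfun n K G ->
  iter_Rintegral n (fun y => F y + c * G y) =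
  iter_Rintegral n F + c * iter_Rintegral n G.

Definition bounded_on_cc n := forall K F M, 0 <= K -> cc_seqfun n K F ->
  (forall y, `|F y| <= M) -> `|iter_Rintegral n F| <= M * (K *+ 2) ^+ n.

(** The volume bound with [M = 0]: a slice taken beyond the support is identically zero. *)
Lemma slice_support n K F t : bounded_on_cc n -> 0 <= K ->
  cc_seqfun n.+1 K F -> K < `|t| ->
  iter_Rintegral n (fun y => F (scons t y)) = 0.
Proof.
move=> bn K0 hF tK; apply/eqP; rewrite -normr_le0.
have -> : (0 : R) = 0 * (K *+ 2) ^+ n by rewrite mul0r.
apply: bn => //; first exact: cc_slice.
by move=> y; rewrite (hF.1 (scons t y) 0) ?normr0.
Qed.

Lemma slice_continuous n K F : linear_on_cc n -> bounded_on_cc n -> 0 <= K ->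
  cc_seqfun n.+1 K F ->
  continuous (fun t => iter_Rintegral n (fun y => F (scons t y))).
Proof.
move=> ln bn K0 hF t.
(* The volume can be 0, since [K = 0] is allowed; adding 1 makes it a legitimate divisor. *)
have D0 : 0 < (K *+ 2) ^+ n + 1.
  by rewrite ltr_wpDl // exprn_ge0 // mulrn_wge0.
apply/cvgrPdist_le => e e0.
have [d d0 Fd] := hF.2 _ (divr_gt0 e0 D0).
near=> s.
have st : `|t - s| <= d.
  by near: s; apply: cvgr_dist_le => //; exact: cvg_id.
rewrite -mulN1r -(ln K) //; [|exact: cc_slice|exact: cc_slice].
have := bn K (fun y => F (scons t y) + -1 * F (scons s y)) (e / ((K *+ 2) ^+ n + 1)) K0.
move=> /(_ (ccD (cc_slice t hF) (ccZ (-1) (cc_slice s hF)))) h.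
apply: le_trans (h _) _.
  by move=> y; rewrite mulN1r; apply: Fd => -[|k] _ //=; rewrite subrr normr0 ltW.
by rewrite mulrAC ler_pdivrMr // ler_wpM2l ?ltW // ltrDl.
Unshelve. all: by end_near. Qed.

Lemma iter_Rintegral_linear_bounded n : linear_on_cc n /\ bounded_on_cc n.
Proof.
elim: n => [|n [ln bn]]; first by split=> // K F M K0 _ /(_ (fun=> 0)); rewrite mulr1.
have cS K F : 0 <= K -> cc_seqfun n.+1 K F ->
    continuous (fun t => iter_Rintegral n (fun y => F (scons t y))).
  exact: slice_continuous.
have sS K F : 0 <= K -> cc_seqfun n.+1 K F ->
    vanishes_off K (fun t => iter_Rintegral n (fun y => F (scons t y))).
  by move=> K0 hF t; exact: (slice_support bn K0 hF).
split=> [K F G c K0 hF hG|K F M K0 hF FM] /=.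
  transitivity (\int[leb]_t (iter_Rintegral n (fun y => F (scons t y)) +
      c * iter_Rintegral n (fun y => G (scons t y)))).
    by congr fine; apply: eq_integral => t _; rewrite (ln K) //; exact: cc_slice.
  have iF := compact_support_integrable (cS _ _ K0 hF) (sS _ _ K0 hF).
  have iG := compact_support_integrable (cS _ _ K0 hG) (sS _ _ K0 hG).
  rewrite RintegralD //; last first.
    by have := integrableZl measurableT c iG; apply: eq_integrable.
  by rewrite RintegralZl.
rewrite exprSr mulrA; apply: integral_line_bound => //.
- exact: (cS _ _ K0 hF).
- exact: (sS _ _ K0 hF).
- by move=> t; apply: bn => //; exact: cc_slice.
Qed.

Lemma iter_RintegralD n K F G : 0 <= K -> cc_seqfun n K F -> cc_seqfun n K G ->
  iter_Rintegral n (fun y => F y + G y) = iter_Rintegral n F + iter_Rintegral n G.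
Proof.
move=> K0 hF hG; rewrite -[iter_Rintegral n G]mul1r.
rewrite -((iter_Rintegral_linear_bounded n).1 K) //.
by congr iter_Rintegral; apply/funext => y; rewrite mul1r.
Qed.

Lemma iter_RintegralZ n K c F : 0 <= K -> cc_seqfun n K F ->
  iter_Rintegral n (fun y => c * F y) = c * iter_Rintegral n F.
Proof.
move=> K0 hF.
have cc0 : cc_seqfun n K (fun=> 0).
  by split=> // e e0; exists 1 => // *; rewrite subrr normr0 ltW.
have I0 : iter_Rintegral n (fun=> 0) = 0.
  have := iter_RintegralD K0 cc0 cc0.
  by under [X in iter_Rintegral n X]eq_fun do rewrite addr0; lra.
rewrite -[RHS]add0r -{1}I0 -((iter_Rintegral_linear_bounded n).1 K) //.
by congr iter_Rintegral; apply/funext => y; rewrite add0r.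
Qed.

Lemma iter_Rintegral_bound n K F M : 0 <= K -> cc_seqfun n K F ->
  (forall y, `|F y| <= M) -> `|iter_Rintegral n F| <= M * (K *+ 2) ^+ n.
Proof. exact: (iter_Rintegral_linear_bounded n).2. Qed.

Lemma cc_slice_continuous n K F : 0 <= K -> cc_seqfun n.+1 K F ->
  continuous (fun t => iter_Rintegral n (fun y => F (scons t y))).
Proof. by apply: slice_continuous; case: (iter_Rintegral_linear_bounded n). Qed.

Lemma cc_slice_vanishes n K F : 0 <= K -> cc_seqfun n.+1 K F ->
  vanishes_off K (fun t => iter_Rintegral n (fun y => F (scons t y))).
Proof.
move=> K0 hF t; apply: slice_support K0 hF.
by case: (iter_Rintegral_linear_bounded n).
Qed.

Lemma iter_Rintegral_ge0 n F : (forall y, 0 <= F y) -> 0 <= iter_Rintegral n F.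
Proof.
elim: n F => [|n IH] F F0 //=.
by apply: Rintegral_ge0 => t _; apply: IH.
Qed.

Lemma iter_Rintegral_gt0 n K F y : 0 <= K -> cc_seqfun n K F ->
  (forall z, 0 <= F z) -> 0 < F y -> 0 < iter_Rintegral n F.
Proof.
move=> K0; elim: n F y => [|n IH] F y hF F0 Fy /=.
  (* With no coordinate to compare, uniform continuity forces [F] to be constant. *)
  suff -> : F (fun=> 0) = F y by [].
  apply/eqP; rewrite -subr_eq0 -normr_le0; apply/ler_addgt0Pl => e e0.
  by rewrite addr0; have [d _] := hF.2 e e0; apply.
apply: (@integral_line_gt0 _ K _ (y 0)).
- exact: cc_slice_continuous hF.
- exact: cc_slice_vanishes hF.
- by move=> t; apply: iter_Rintegral_ge0.
- apply: (IH _ (fun k => y k.+1)) => //; first exact: cc_slice.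
  by rewrite (_ : scons _ _ = y) //; apply/funext => -[].
Qed.

Definition translate_at i h y : nat -> R := fun k => if k == i then y k + h else y k.

Lemma iter_Rintegral_translate n K F i h : 0 <= K -> (i < n)%N ->
  cc_seqfun n K F ->
  iter_Rintegral n (fun y => F (translate_at i h y)) = iter_Rintegral n F.
Proof.
move=> K0; elim: n F i => [|n IH] F [|i] // ni hF /=.
  rewrite -[RHS](integral_line_translate h (cc_slice_continuous K0 hF)
                                           (cc_slice_vanishes K0 hF)).
  congr fine; apply: eq_integral => t _; congr (iter_Rintegral _ _)%:E.
  by apply/funext => y; congr F; apply/funext => -[].
congr fine; apply: eq_integral => t _; rewrite -(IH _ _ ni (cc_slice t hF)).
congr (iter_Rintegral _ _)%:E.
by apply/funext => y; congr F; apply/funext => -[].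
Qed.

Lemma iter_integral_EFin n K F : 0 <= K -> cc_seqfun n K F ->
  iter_integral n (fun y => (F y)%:E) = (iter_Rintegral n F)%:E.
Proof.
move=> K0; elim: n F => [|n IH] F hF //=.
rewrite /Rintegral fineK; last first.
  apply: integrable_fin_num => //.
  exact: compact_support_integrable (cc_slice_continuous K0 hF)
                                    (cc_slice_vanishes K0 hF).
by apply: eq_integral => t _; rewrite -IH //; exact: cc_slice.
Qed.

(** Nonnegativity is carried along because comparing the outer integrals requires it of the inner
    ones. *)
Lemma le_iter_integral n (F G : (nat -> R) -> \bar R) :
  (forall y, 0 <= F y)%E -> (forall y, F y <= G y)%E ->
  (0 <= iter_integral n F <= iter_integral n G)%E.
Proof.
elim: n F G => [|n IH] F G F0 FG /=; first by rewrite F0 FG.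
have h t := IH (fun y => F (scons t y)) (fun y => G (scons t y))
  (fun y => F0 _) (fun y => FG _).
apply/andP; split.
  by apply: integral_ge0 => t _; case/andP: (h t).
by apply: ge0_le_integral_nomeas => t; case/andP: (h t).
Qed.

(** [c] is an extended real because the outer integral is taken of the inner one, which is already
    the constant [+oo]. *)
Lemma iter_integral_cst n (c : \bar R) : (0 < c)%E ->
  iter_integral n.+1 (fun=> c) = +oo%E.
Proof.
have step (b : \bar R) : (0 < b)%E -> (\int[leb]_t b = +oo)%E.
  move=> b0; rewrite integral_cst // [X in (_ * X)%E](_ : _ = +oo%E) ?gt0_muley //.
  by have := @lebesgue_measure_itv R `]-oo, +oo[; rewrite set_itvNyy.
elim: n c => [|n IH] c c0; first exact: step.
have -> : iter_integral n.+2 (fun=> c) = (\int[leb]_t iter_integral n.+1 (fun=> c))%E by [].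
by rewrite IH // step.
Qed.

End iterated_integral.

(** * Continuity under pointwise operations *)

Section pointwise_continuity.
Variables (R : realType) (T : topologicalType).
Implicit Types f g : T -> R.

Lemma cts_cst (c : R) : continuous (fun _ : T => c).
Proof. by move=> x; exact: cvg_cst. Qed.

Lemma ctsM f g : continuous f -> continuous g -> continuous (fun x => f x * g x).
Proof. by move=> cf cg x; apply: cvgM; [exact: cf|exact: cg]. Qed.

Lemma ctsD f g : continuous f -> continuous g -> continuous (fun x => f x + g x).
Proof. by move=> cf cg x; apply: cvgD; [exact: cf|exact: cg]. Qed.

Lemma ctsB f g : continuous f -> continuous g -> continuous (fun x => f x - g x).
Proof. by move=> cf cg x; apply: cvgB; [exact: cf|exact: cg]. Qed.

Lemma cts_sum (I : finType) (F : I -> T -> R) :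
  (forall i, continuous (F i)) -> continuous (fun x => \sum_i F i x).
Proof.
move=> cF; rewrite (_ : (fun x => _) = \sum_i F i); last first.
  by apply/funext => x; rewrite fct_sumE.
by elim/big_ind: _ => [|f g cf cg|i _]; [exact: cts_cst|exact: ctsD|exact: cF].
Qed.

End pointwise_continuity.

(** * Integration over row vectors and the vanishing integral of a partial derivative *)

Section row_integral.
Variables (R : realType) (d : nat).
Implicit Types (g : 'rV[R]_d -> R) (x : 'rV[R]_d) (K M h : R) (i : 'I_d).
Local Notation e_ i := (delta_mx 0 i : 'rV[R]_d).

Lemma row_norm_le x h : 0 <= h -> (forall i, `|x ord0 i| <= h) -> `|x| <= h.
Proof.
move=> h0 xh; rewrite [leLHS]/Num.norm /= mx_normrE; apply: bigmax_le => //= -[j i] _.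
by rewrite (ord1 j); apply: xh.
Qed.

Lemma coord_le_row_norm x i : `|x ord0 i| <= `|x|.
Proof.
rewrite [leRHS]/Num.norm /= mx_normrE; apply/bigmax_geP; right => /=.
by exists (ord0, i).
Qed.

Lemma row_partial_line g x i : (forall z, derivable g z (e_ i)) ->
  forall c, is_derive c (1 : R) (fun t : R => g (x + t *: e_ i))
                      (partial i g (x + c *: e_ i)).
Proof.
move=> dg c.
have E : (fun h : R => h^-1 *: (((fun t : R => g (x + t *: e_ i)) \o shift c) (h *: (1 : R))
             - g (x + c *: e_ i)))
       = (fun h => h^-1 *: ((g \o shift (x + c *: e_ i)) (h *: e_ i)
             - g (x + c *: e_ i))).
  apply/funext => h /=; congr (_ *: (g _ - _)).
  by rewrite [h *: 1]mulr1 scalerDl addrCA.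
by split; rewrite /derivable /partial /derive E //; apply: dg.
Qed.

Lemma partial_MVT g x i h : 0 <= h -> (forall z, derivable g z (e_ i)) ->
  exists2 c, 0 <= c <= h &
    g (x + h *: e_ i) - g x = partial i g (x + c *: e_ i) * h.
Proof.
move=> h0 dg.
have H := row_partial_line x dg.
have [|c] := @MVT_segment R (fun t : R => g (x + t *: e_ i))
   (fun c => partial i g (x + c *: e_ i)) 0 h h0 (fun c _ => H c).
  apply: continuous_subspaceT => c.
  apply: differentiable_continuous; apply/derivable1_diffP.
  by have [] := H c.
rewrite in_itv /= scale0r addr0 subr0 => ch E.
by exists c.
Qed.

Definition vanishes_off_cube K g := forall x i, K < `|x ord0 i| -> g x = 0.

Lemma vanishes_off_cubeW K K' g :
  K <= K' -> vanishes_off_cube K g -> vanishes_off_cube K' g.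
Proof. by move=> KK' g0 x i ?; apply: (g0 x i); apply: le_lt_trans KK' _. Qed.

Lemma cube_uniformly_continuous K g : continuous g -> vanishes_off_cube K g ->
  forall e, 0 < e -> exists2 r, 0 < r & forall x z, `|x - z| <= r -> `|g x - g z| <= e.
Proof.
move=> cg g0 e e0.
pose C := [set x : 'rV[R]_d | forall i, x ord0 i \in `[- K, K]].
have cC : compact C.
  apply: (@rV_compact _ _ (fun=> `[- K, K]%classic)) => _; exact: segment_compact.
have /compact_near_coveringP cov := cC.
(* Compactness in near-covering form: a radius that works near each point of [C] gives one that
   works on all of [C]. *)
have : \forall r \near 0^'+, C `<=` (fun x => forall z, `|x - z| <= r -> `|g x - g z| <= e).
  apply: (cov _ (0 : R)^'+ (fun r x => forall z, `|x - z| <= r -> `|g x - g z| <= e)) => x Cx.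
  have e2 : 0 < e / 2 by rewrite divr_gt0.
  have /cvgrPdist_lt/(_ _ e2) /nbhs_ballP[r /= r0 xr] := cg x.
  have r2 : 0 < r / 2 by rewrite divr_gt0.
  exists (ball x (r / 2), [set s | s < r / 2]).
    by split; [exact: nbhsx_ballx|apply: nbhs_right_lt].
  move=> [x' s] [/= xx' sr] z x'z.
  rewrite -ball_normE /= in xx'.
  have h1 : `|g x - g x'| < e / 2.
    by apply: xr; rewrite -ball_normE /=; lra.
  have h2 : `|g x - g z| < e / 2.
    apply: xr; rewrite -ball_normE /=.
    by have := ler_distD x' x z; lra.
  by have := ler_distD (g x) (g x') (g z); rewrite (distrC (g x') (g x)); lra.
move=> Cr.
have [r [r0 rC]] := filter_ex (filterI (nbhs_right_gt (0 : R)) Cr).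
exists r => // x z xz.
(* Two points off the cube have equal values 0; if only one point lies in [C], symmetry puts it
   first. *)
have notC u : ~ C u -> g u = 0.
  move=> /existsNP[i /negP]; rewrite in_itv /= -ler_norml -ltNge; exact: g0.
have [Cx|nCx] := pselect (C x); first exact: rC.
have [Cz|nCz] := pselect (C z).
  by rewrite distrC; apply: (rC z Cz); rewrite distrC.
by rewrite !notC // subrr normr0 ltW.
Qed.

Definition cube_integral g : R :=
  iter_Rintegral d (fun y => g (\row_(i < d) y (nat_of_ord i))).

Lemma cc_of_row K g : continuous g -> vanishes_off_cube K g ->
  cc_seqfun d K (fun y => g (\row_(i < d) y (nat_of_ord i))).
Proof.
move=> cg g0; split=> [y k kd Ky|e e0].
  by apply: (g0 _ (Ordinal kd)); rewrite mxE.
have [r r0 gr] := cube_uniformly_continuous cg g0 e0.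
exists r => // y z yz; apply: gr; apply: row_norm_le => [|i]; first exact: ltW.
by rewrite !mxE; apply: yz.
Qed.

Lemma cube_integralD K f g : 0 <= K -> continuous f -> vanishes_off_cube K f ->
  continuous g -> vanishes_off_cube K g ->
  cube_integral (fun x => f x + g x) = cube_integral f + cube_integral g.
Proof. by move=> K0 *; apply: (iter_RintegralD K0); exact: cc_of_row. Qed.

Lemma cube_integralZ K c g : 0 <= K -> continuous g -> vanishes_off_cube K g ->
  cube_integral (fun x => c * g x) = c * cube_integral g.
Proof. by move=> K0 *; apply: (iter_RintegralZ _ K0); exact: cc_of_row. Qed.

Lemma cube_integralB K f g : 0 <= K -> continuous f -> vanishes_off_cube K f ->
  continuous g -> vanishes_off_cube K g ->
  cube_integral (fun x => f x - g x) = cube_integral f - cube_integral g.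
Proof.
move=> K0 cf f0 cg g0.
rewrite -[in RHS]mulN1r -(cube_integralZ _ K0) // -(cube_integralD K0) //.
- by congr cube_integral; apply/funext => x; rewrite mulN1r.
- by apply: ctsM => //; exact: cts_cst.
- by move=> x i /g0 ->; rewrite mulr0.
Qed.

Lemma cube_integral_bound K g M : 0 <= K -> continuous g ->
  vanishes_off_cube K g -> (forall x, `|g x| <= M) ->
  `|cube_integral g| <= M * (K *+ 2) ^+ d.
Proof.
by move=> K0 cg g0 gM; apply: iter_Rintegral_bound => //; exact: cc_of_row.
Qed.

Lemma le_cube_integral K f g : 0 <= K -> continuous f -> vanishes_off_cube K f ->
  continuous g -> vanishes_off_cube K g -> (forall x, f x <= g x) ->
  cube_integral f <= cube_integral g.
Proof.
move=> K0 cf f0 cg g0 fg; rewrite -subr_ge0 -(cube_integralB K0) //.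
by apply: iter_Rintegral_ge0 => y; rewrite subr_ge0.
Qed.

Lemma cube_integral_gt0 K g x : 0 <= K -> continuous g -> vanishes_off_cube K g ->
  (forall z, 0 <= g z) -> 0 < g x -> 0 < cube_integral g.
Proof.
move=> K0 cg g0 gge0 gx.
pose y k := if insub k is Some i then x ord0 i else 0.
apply: (@iter_Rintegral_gt0 _ _ K _ y) => //; first exact: cc_of_row.
rewrite (_ : \row_i _ = x) //; apply/rowP => i.
by rewrite mxE /y valK.
Qed.

(** The bridge from the finiteness hypotheses to real bounds: the minorant [f] has a real iterated
    integral, which is then compared with that of [g] in the extended reals. *)
Lemma le_cube_integral_Rd_integral K f g : 0 <= K -> continuous f ->
  vanishes_off_cube K f -> (forall x, 0 <= f x) -> (forall x, f x <= g x) ->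
  ((cube_integral f)%:E <= Rd_integral (fun x => (g x)%:E))%E.
Proof.
move=> K0 cf f0 fge0 fg.
rewrite /cube_integral -(iter_integral_EFin K0); last exact: cc_of_row.
have le := @le_iter_integral R d
  (fun y => (f (\row_(i < d) y (nat_of_ord i)))%:E)
  (fun y => (g (\row_(i < d) y (nat_of_ord i)))%:E).
by have /andP[] := le (fun y => fge0 _) (fun y => fg _).
Qed.

Lemma cube_integral_translate K g i h : 0 <= K -> continuous g ->
  vanishes_off_cube K g ->
  cube_integral (fun x => g (x + h *: e_ i)) = cube_integral g.
Proof.
move=> K0 cg g0.
rewrite /cube_integral -(iter_Rintegral_translate h K0 (ltn_ord i) (cc_of_row cg g0)).
congr iter_Rintegral; apply/funext => y; congr g; apply/rowP => j.
rewrite !mxE /translate_at /= -[j == i]/(nat_of_ord j == nat_of_ord i).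
by case: eqP => _; rewrite ?mulr1 ?mulr0 ?addr0.
Qed.

(* Difference quotients integrate to 0 by translation invariance and converge
   uniformly to the partial derivative; no Fubini theorem is needed. *)
Lemma cube_integral_partial K g i : 0 <= K -> continuous g ->
  vanishes_off_cube K g -> (forall x, derivable g x (e_ i)) ->
  continuous (partial i g) -> vanishes_off_cube K (partial i g) ->
  cube_integral (partial i g) = 0.
Proof.
move=> K0 cg g0 dg cdg dg0.
have K10 : 0 <= K + 1 by rewrite addr_ge0.
have KK1 : K <= K + 1 by rewrite lerDl.
have D0 : 0 < ((K + 1) *+ 2) ^+ d + 1 by rewrite ltr_wpDl // exprn_ge0 // mulrn_wge0.
apply/eqP; rewrite -normr_le0; apply/ler_addgt0Pl => e e0; rewrite addr0.
have [r r0 dgr] := cube_uniformly_continuous cdg dg0 (divr_gt0 e0 D0).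
(* [h <= r] brings the mean value point within reach of uniform continuity; [h <= 1] keeps the
   translate of [g] supported in the cube of half-side [K + 1]. *)
pose h := Num.min r 1.
have h0 : 0 < h by rewrite lt_min r0 /=.
have hr : h <= r by rewrite ge_min lexx.
have h1 : h <= 1 by rewrite ge_min lexx orbT.
pose gh x := g (x + h *: e_ i).
have cgh : continuous gh.
  have cs : continuous (fun x : 'rV[R]_d => x + h *: e_ i).
    by move=> x; apply: (cvgD (@cvg_id _ _) (@cvg_cst _ _ _ _ _)).
  by move=> x; apply: continuous_comp; [exact: cs|exact: cg].
have gh0 : vanishes_off_cube (K + 1) gh.
  move=> x j xj; apply: (g0 _ j); rewrite !mxE eqxx /=.
  have := lerB_normD (x ord0 j) (h * (j == i)%:R).
  suff : `|h * (j == i)%:R| <= 1 by lra.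
  by rewrite normrM (gtr0_norm h0); case: (j == i); rewrite /= ?normr1 ?normr0 ?mulr1 ?mulr0.
have g10 := vanishes_off_cubeW KK1 g0.
have dg10 := vanishes_off_cubeW KK1 dg0.
pose q x := h^-1 * (gh x - g x).
have cq : continuous q.
  by apply: ctsM; [exact: cts_cst|exact: ctsB].
have q0 : vanishes_off_cube (K + 1) q.
  by move=> x j xj; rewrite /q (gh0 x j) // (g10 x j) // subrr mulr0.
have Iq : cube_integral q = 0.
  rewrite /q (cube_integralZ _ K10); first last.
  - by move=> x j xj; rewrite (gh0 x j) // (g10 x j) // subrr.
  - exact: ctsB.
  rewrite (cube_integralB K10) // /gh (cube_integral_translate _ _ K0) //.
  by rewrite subrr mulr0.
have -> : cube_integral (partial i g) = cube_integral (fun x => partial i g x - q x).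
  by rewrite (cube_integralB K10) // Iq subr0.
have -> : e = e / (((K + 1) *+ 2) ^+ d + 1) * (((K + 1) *+ 2) ^+ d + 1).
  by rewrite divfK // gt_eqF.
apply: (@le_trans _ _ (e / (((K + 1) *+ 2) ^+ d + 1) * ((K + 1) *+ 2) ^+ d)); last first.
  by rewrite ler_wpM2l ?lerDl // divr_ge0 // ltW.
apply: cube_integral_bound => //.
- exact: ctsB.
- by move=> x j xj; rewrite (q0 x j) // (dg10 x j) // subrr.
move=> x; have [c /andP[c0 ch] E] := partial_MVT x (ltW h0) dg.
rewrite /q /gh E mulrCA mulVf ?gt_eqF // mulr1; apply: dgr.
rewrite opprD addrA subrr sub0r normrN; apply: row_norm_le => [|j]; first exact: ltW.
rewrite !mxE eqxx /= normrM (ger0_norm c0).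
by case: (j == i); rewrite /= ?normr1 ?normr0 ?mulr1 ?mulr0; [apply: le_trans hr|apply: ltW].
Qed.

End row_integral.

(** * Continuously differentiable functions and symmetry of second derivatives *)

Section calculus.
Variables (R : realType) (d : nat).
Implicit Types (f g : 'rV[R]_d -> R) (x : 'rV[R]_d) (i j : 'I_d).
Local Notation e_ i := (delta_mx 0 i : 'rV[R]_d).

Definition C1 f := continuous f /\
  forall i, (forall x, derivable f x (e_ i)) /\ continuous (partial i f).

Lemma C1_cst (c : R) : C1 (fun=> c).
Proof.
split; first exact: cts_cst.
move=> i; split=> [x|]; first exact: derivable_cst.
rewrite (_ : partial i _ = fun=> 0); first exact: cts_cst.
by apply/funext => x; rewrite /partial derive_cst.
Qed.

Lemma partialD i f g x : C1 f -> C1 g ->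
  partial i (fun y => f y + g y) x = partial i f x + partial i g x.
Proof. by move=> [_ /(_ i)[df _]] [_ /(_ i)[dg _]]; rewrite /partial deriveD. Qed.

Lemma partialM i f g x : C1 f -> C1 g ->
  partial i (fun y => f y * g y) x = f x * partial i g x + g x * partial i f x.
Proof. by move=> [_ /(_ i)[df _]] [_ /(_ i)[dg _]]; rewrite /partial deriveM. Qed.

Lemma C1D f g : C1 f -> C1 g -> C1 (fun y => f y + g y).
Proof.
move=> Cf Cg; have [cf df] := Cf; have [cg dg] := Cg.
split; first exact: ctsD.
move=> i; have [dfi cfi] := df i; have [dgi cgi] := dg i.
split=> [x|]; first exact: derivableD.
rewrite (_ : partial i _ = fun x => partial i f x + partial i g x); first exact: (ctsD cfi cgi).
by apply/funext => x; rewrite partialD.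
Qed.

Lemma C1M f g : C1 f -> C1 g -> C1 (fun y => f y * g y).
Proof.
move=> Cf Cg; have [cf df] := Cf; have [cg dg] := Cg.
split; first exact: ctsM.
move=> i; have [dfi cfi] := df i; have [dgi cgi] := dg i.
split=> [x|]; first exact: derivableM.
rewrite (_ : partial i _ = fun x => f x * partial i g x + g x * partial i f x).
  exact: (ctsD (ctsM cf cgi) (ctsM cg cfi)).
by apply/funext => x; rewrite partialM.
Qed.

Lemma partial_cst i (c : R) x : partial i (fun=> c) x = 0.
Proof. by rewrite /partial derive_cst. Qed.

Lemma partialZ i (c : R) f x : C1 f -> partial i (fun y => c * f y) x = c * partial i f x.
Proof. by move=> Cf; rewrite partialM ?partial_cst ?mulr0 ?addr0 //; exact: C1_cst. Qed.

Lemma C1Z (c : R) f : C1 f -> C1 (fun y => c * f y).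
Proof. by apply: C1M; exact: C1_cst. Qed.

Lemma C1_partial_sum (I : finType) (F : I -> 'rV[R]_d -> R) : (forall k, C1 (F k)) ->
  C1 (fun y => \sum_k F k y) /\
  forall i x, partial i (fun y => \sum_k F k y) x = \sum_k partial i (F k) x.
Proof.
move=> CF; elim: (index_enum I) => [|k s [IH1 IH2]].
  under eq_fun do rewrite big_nil; split; first exact: C1_cst.
  by move=> i x; rewrite big_nil partial_cst.
have E : (fun y => \sum_(l <- k :: s) F l y) = (fun y => F k y + \sum_(l <- s) F l y).
  by apply/funext => y; rewrite big_cons.
rewrite E; split; first exact: C1D.
by move=> i x; rewrite big_cons -IH2 -partialD // E.
Qed.

Lemma C1_sum (I : finType) (F : I -> 'rV[R]_d -> R) :
  (forall k, C1 (F k)) -> C1 (fun y => \sum_k F k y).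
Proof. by case/C1_partial_sum. Qed.

Lemma partial_sum (I : finType) (F : I -> 'rV[R]_d -> R) i x :
  (forall k, C1 (F k)) ->
  partial i (fun y => \sum_k F k y) x = \sum_k partial i (F k) x.
Proof. by case/C1_partial_sum. Qed.

Lemma C1_partial_comp (phi phi' : R -> R) f :
  (forall t, is_derive t (1 : R) phi (phi' t)) -> continuous phi' -> C1 f ->
  C1 (fun y => phi (f y)) /\
  forall i x, partial i (fun y => phi (f y)) x = phi' (f x) * partial i f x.
Proof.
move=> dphi cphi' [cf df].
have cphi : continuous phi.
  move=> t; apply: differentiable_continuous; apply/derivable1_diffP.
  by have [] := dphi t.
have D i x : is_derive x (e_ i) (fun y => phi (f y)) (phi' (f x) * partial i f x).
  have [dfi _] := df i.
  (* The one-variable chain rule is used on the line through [x], at parameter 0; [Q] identifies the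
     two difference quotients. *)
  have L := row_partial_line x dfi 0.
  have P := dphi (f (x + 0 *: e_ i)).
  have [C1' C2'] := is_derive1_comp P L.
  have Q : (fun h : R => h^-1 *: (((phi \o (fun t : R => f (x + t *: e_ i))) \o shift (0 : R)) (h *: (1 : R))
             - phi (f (x + 0 *: e_ i))))
       = (fun h => h^-1 *: (((fun y => phi (f y)) \o shift x) (h *: e_ i)
             - phi (f x))).
    apply/funext => h /=; rewrite scale0r !addr0.
    have -> : h *: (1 : R) = h by exact: mulr1.
    by rewrite (addrC x).
  rewrite /derivable /derive Q scale0r addr0 in C1' C2'.
  by split.
have E i : partial i (fun y => phi (f y)) = fun x => phi' (f x) * partial i f x.
  by apply/funext => x; case: (D i x).
split; last by move=> i x; rewrite E.
split; first by move=> x; apply: continuous_comp; [exact: cf|exact: cphi].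
move=> i; split=> [x|]; first by case: (D i x).
rewrite E; apply: ctsM; last exact: (df i).2.
by move=> x; apply: continuous_comp; [exact: cf|exact: cphi'].
Qed.

Lemma C1_coord j : C1 (fun x => x ord0 j) /\
  forall i x, partial i (fun x => x ord0 j) x = (i == j)%:R.
Proof.
have D i x : is_derive x (e_ i) (fun x => x ord0 j) (i == j)%:R.
  have E : (fun h : R => h^-1 *: (((fun x : 'rV[R]_d => x ord0 j) \o shift x) (h *: e_ i) - x ord0 j))
      @ 0^' --> ((i == j)%:R : R).
    apply: (@cvg_trans _ ((cst (i == j)%:R) @ (0 : R)^')); last exact: cvg_cst.
    apply: near_eq_cvg; near=> h.
    have h0 : h != 0 by near: h; exact: nbhs_dnbhs_neq.
    rewrite /= !mxE eqxx /= addrK eq_sym [_ *: _]mulrA mulVf // mul1r //.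
  by split; [apply/cvg_ex; exists (i == j)%:R|exact: cvg_lim E].
have E i : partial i (fun x => x ord0 j) = fun=> (i == j)%:R.
  by apply/funext => x; case: (D i x).
split; last by move=> i x; rewrite E.
split; first exact: coord_continuous.
by move=> i; rewrite E; split; [move=> x; case: (D i x)|exact: cts_cst].
Unshelve. all: by end_near. Qed.

(** The last index in the list is the derivative taken first, hence smoothness passes to
    [partial i f]. *)
Lemma partials_rcons s i f : partials (rcons s i) f = partials s (partial i f).
Proof. by elim: s => //= j s ->. Qed.

Lemma smooth_partial i f : smooth f -> smooth (partial i f).
Proof. by move=> sf s x; rewrite -partials_rcons; exact: sf. Qed.

Lemma smooth_C1 f : smooth f -> C1 f.
Proof.
move=> sf; split=> [x|i]; first exact: differentiable_continuous (sf [::] x).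
split=> [x|x]; first exact: diff_derivable (sf [::] x).
exact: differentiable_continuous (sf [:: i] x).
Qed.

Lemma partial_translate i f w x :
  partial i (fun y => f (y + w)) x = partial i f (x + w).
Proof.
rewrite /partial /derive (_ : (fun h : R => h^-1 *: ((f \o shift (x + w)) (h *: e_ i) - f (x + w)))
  = (fun h => h^-1 *: (((fun y => f (y + w)) \o shift x) (h *: e_ i) - f (x + w)))) //.
by apply/funext => h /=; rewrite addrA.
Qed.

Lemma derivable_translate f w x v :
  derivable f (x + w) v -> derivable (fun y => f (y + w)) x v.
Proof.
rewrite /derivable (_ : (fun h : R => h^-1 *: ((f \o shift (x + w)) (h *: v) - f (x + w)))
  = (fun h => h^-1 *: (((fun y => f (y + w)) \o shift x) (h *: v) - f (x + w)))) //.
by apply/funext => h /=; rewrite addrA.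
Qed.

Lemma partialB i f g x : derivable f x (e_ i) -> derivable g x (e_ i) ->
  partial i (fun y => f y - g y) x = partial i f x - partial i g x.
Proof. by move=> df dg; exact: deriveB. Qed.

(* Unification must not unfold iterated partial derivatives down to limits. *)
Opaque partial.

(** The mean value theorem is used twice: in direction [i] on the increment [u] in direction [j],
    then in direction [j] on [partial i f]. *)
Lemma second_difference_MVT f x i j h : 0 < h -> C1 f -> C1 (partial i f) ->
  exists p, `|x - p| <= h *+ 2 /\
    f (x + h *: e_ i + h *: e_ j) - f (x + h *: e_ i)
      - (f (x + h *: e_ j) - f x) = partial j (partial i f) p * h * h.
Proof.
move=> h0 [cf df] [_ ddf]; have [dfi _] := df i; have [ddfij _] := ddf j.
pose u y := f (y + h *: e_ j) - f y.
have du y : derivable u y (e_ i).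
  apply: (@derivableB _ _ _ (fun y => f (y + h *: e_ j)) f) => //.
  exact: derivable_translate.
have pu y : partial i u y = partial i f (y + h *: e_ j) - partial i f y.
  by rewrite partialB ?partial_translate //; exact: derivable_translate.
have [c /andP[c0 ch] E1] := partial_MVT x (ltW h0) du.
have [c' /andP[c0' ch'] E2] := partial_MVT (x + c *: e_ i) (ltW h0) ddfij.
exists (x + c *: e_ i + c' *: e_ j); split; last first.
  by rewrite -E2 -pu -E1 /u.
rewrite -addrA opprD addrA subrr sub0r normrN mulr2n.
have bound k (s : R) : 0 <= s <= h -> `|s *: e_ k| <= h.
  move=> /andP[s0 sh]; apply: row_norm_le => [|l]; first exact: ltW.
  rewrite !mxE eqxx /= normrM (ger0_norm s0).
  by case: (l == k); rewrite /= ?normr1 ?normr0 ?mulr1 ?mulr0 // ltW.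
by rewrite (le_trans (ler_normD _ _)) // lerD // bound // ?c0 ?c0'.
Qed.

Lemma half_close (a b c e : R) :
  `|a - b| < e / 2 -> `|c - b| < e / 2 -> `|a - c| <= e.
Proof.
move=> ab cb; apply: le_trans (ler_distD b a c) _.
by rewrite (distrC b c) [leRHS]splitr lerD // ltW.
Qed.

(** The second difference is symmetric in [i] and [j], so the two mixed derivatives agree at points
    [p] and [p'] within [h *+ 2] of [x]; continuity at [x] does the rest. *)
Lemma partial_comm f i j x : C1 f -> C1 (partial i f) -> C1 (partial j f) ->
  partial j (partial i f) x = partial i (partial j f) x.
Proof.
move=> Cf Ci Cj.
apply/eqP; rewrite -subr_eq0 -normr_le0; apply/ler_addgt0Pl => e e0; rewrite addr0.
have e2 : 0 < e / 2 by rewrite divr_gt0.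
have [_ /(_ j)[_ cij]] := Ci; have [_ /(_ i)[_ cji]] := Cj.
have /cvgrPdist_lt/(_ _ e2) /nbhs_ballP[r /= r0 xr] := cij x.
have /cvgrPdist_lt/(_ _ e2) /nbhs_ballP[s /= s0 xs] := cji x.
pose h := Num.min r s / 4.
have h0 : 0 < h by rewrite divr_gt0 // lt_min r0.
have hm : h *+ 2 < Num.min r s.
  by have : 0 < Num.min r s; [rewrite lt_min r0|rewrite /h mulr2n; lra].
have [hr hs] : h *+ 2 < r /\ h *+ 2 < s by move: hm; rewrite lt_min => /andP.
clearbody h.
have [p [xp E1]] := second_difference_MVT x j h0 Cf Ci.
have [p' [xp' E2]] := second_difference_MVT x i h0 Cf Cj.
have E : partial j (partial i f) p = partial i (partial j f) p'.
  apply: (mulIf (lt0r_neq0 h0)); apply: (mulIf (lt0r_neq0 h0)).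
  have sw : x + h *: e_ j + h *: e_ i = x + h *: e_ i + h *: e_ j by exact: addrAC.
  rewrite sw in E2; apply: etrans (esym E1) (etrans _ E2).
  move: (f (x + h *: e_ i + h *: e_ j)) (f (x + h *: e_ i)) (f (x + h *: e_ j)) (f x).
  by move=> *; ring.
have A := xr p; have B := xs p'.
rewrite -!ball_normE /= in A B.
have {}A := A (le_lt_trans xp hr); have {}B := B (le_lt_trans xp' hs).
by rewrite -E in B; exact: (half_close A B).
Qed.

End calculus.

(** * Powers and the squared positive part on the line *)

Section scalar_functions.
Variable R : realType.

Lemma cts_norm_powR (p : R) : 0 < p -> continuous (fun t : R => `|t| `^ p).
Proof.
move=> p0 t; have [->|t0] := eqVneq t 0.
  apply/cvgrPdist_lt => e e0.
  have N : \forall s \near (0 : R), `|s| < e `^ p^-1.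
    by apply: nbhs0_lt; rewrite powR_gt0.
  near=> s.
  rewrite normr0 powR0 ?gt_eqF // sub0r normrN ger0_norm ?powR_ge0 //.
  have -> : e = (e `^ p^-1) `^ p by rewrite -powRrM mulVf ?gt_eqF // powRr1 // ltW.
  apply: gt0_ltr_powR => //; rewrite ?nnegrE ?powR_ge0 //.
  by near: s.
have nt0 : 0 < `|t| by rewrite normr_gt0.
apply: (@continuous_comp _ _ _ (fun t : R => `|t|) (fun s => s `^ p)).
  exact: norm_continuous.
apply: differentiable_continuous; apply/derivable1_diffP.
by have [] := is_derive1_powR p nt0.
Unshelve. all: by end_near. Qed.

(* The odd extension of [t ^ p] is C^1 on the whole line, so that composing it
   with a nonnegative density needs no special treatment of the vacuum. *)
Lemma is_derive_odd_powR (p : R) : 1 < p -> forall t : R,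
  is_derive t (1 : R) (fun t => t * `|t| `^ (p - 1)) (p * `|t| `^ (p - 1)).
Proof.
move=> p1 t; have p10 : 0 < p - 1 by rewrite subr_gt0.
have p0 : 0 < p by apply: lt_trans p1.
have [t0|t0|->] := ltgtP t 0.
- have nt0 : 0 < - t by rewrite oppr_gt0.
  have D : is_derive t (1 : R) (fun t => - ((- t) `^ p)) (p * (- t) `^ (p - 1)).
    have D1 : is_derive t (1 : R) (fun t : R => - t) (-1).
      by apply: is_derive_eq.
    have D2 := is_derive1_comp (is_derive1_powR p nt0) D1.
    apply: (@is_derive_eq _ _ _ _ _ _ _ _ (is_deriveN D2)).
    by rewrite mulrN1 opprK.
  rewrite (ltr0_norm t0); apply: near_eq_is_derive D.
  near=> s; have s0 : s < 0 by near: s; exact: lt_nbhsl.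
  rewrite ltr0_norm // -(@mulr_powRB1 _ (- s) p) ?oppr_ge0 ?ltW //; ring.
- have D := is_derive1_powR p t0.
  rewrite -[in p * _](gtr0_norm t0) in D.
  apply: near_eq_is_derive D.
  near=> s; have s0 : 0 < s by near: s; exact: lt_nbhsr.
  by rewrite gtr0_norm // mulr_powRB1 // ltW.
- have E : (fun h : R =>
      h^-1 *: (((fun t : R => t * `|t| `^ (p - 1)) \o shift 0) (h *: 1)
               - (0 : R) * `|0 : R| `^ (p - 1))) @ 0^' --> p * `|0 : R| `^ (p - 1).
    have -> : p * `|0 : R| `^ (p - 1) = `|0 : R| `^ (p - 1).
      by rewrite normr0 powR0 ?mulr0 // gt_eqF.
    apply: (@cvg_trans _ ((fun h : R => `|h| `^ (p - 1)) @ (0 : R)^')).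
      apply: near_eq_cvg; near=> h.
      have h0 : h != 0 by near: h; exact: nbhs_dnbhs_neq.
      by rewrite /= [h *: 1]mulr1 addr0 mul0r subr0 [_ *: _]mulrA mulVf // mul1r.
    apply: cvg_within_filter; exact: (cts_norm_powR p10).
  by split; [apply/cvg_ex; eexists; exact: E|exact: cvg_lim E].
Unshelve. all: by end_near. Qed.

(** A C^1 truncation whose derivative is twice its own square root. This is the source of the bound
    of the gradient of the cutoff by its square root. *)
Definition sqpos (t : R) := Num.max t 0 ^+ 2.

Lemma is_derive_sqpos (t : R) : is_derive t (1 : R) sqpos (2 * Num.max t 0).
Proof.
have E : (fun h : R => h^-1 *: ((sqpos \o shift t) (h *: 1) - sqpos t))
    @ 0^' --> 2 * Num.max t 0.
  apply/cvgrPdist_le => e e0; near=> h.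
  have h0 : h != 0 by near: h; exact: nbhs_dnbhs_neq.
  have he : `|h| <= e by near: h; apply: dnbhs0_le.
  rewrite /= [h *: 1]mulr1; apply: le_trans he.
  have -> : 2 * Num.max t 0 - h^-1 *: (sqpos (h + t) - sqpos t)
     = h^-1 * (2 * h * Num.max t 0 + sqpos t - sqpos (h + t)).
    have -> : h^-1 *: (sqpos (h + t) - sqpos t) = h^-1 * (sqpos (h + t) - sqpos t) by [].
    by move: (sqpos _) (sqpos _) (Num.max t 0) => a b m; field.
  rewrite normrM normfV ler_pdivrMl ?normr_gt0 // -normrM -expr2 (ger0_norm (sqr_ge0 h)).
  rewrite ler_norml /sqpos.
  (* In each of the four sign cases the first-order Taylor remainder is at most [h ^+ 2] in absolute
     value. *)
  by case: (ltP t 0) => ?; case: (ltP (h + t) 0) => ?; nra.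
by split; [apply/cvg_ex; eexists; exact: E|exact: cvg_lim E].
Unshelve. all: by end_near. Qed.

Lemma cts_maxr0 : continuous (fun t : R => Num.max t 0).
Proof.
by move=> x; apply: (@continuous_max _ _ id (cst 0)); [exact: cvg_id|exact: cvg_cst].
Qed.

End scalar_functions.

(** * Cutoff functions of cubes *)

Section cutoff.
Variables (R : realType) (d : nat).
Implicit Types (x : 'rV[R]_d) (r : R) (i j : 'I_d).

Lemma sqpos_ge0 (t : R) : 0 <= sqpos t.
Proof. exact: sqr_ge0. Qed.

Lemma sqpos_le0 (t : R) : t <= 0 -> sqpos t = 0.
Proof. by move=> t0; rewrite /sqpos (max_idPr t0) expr0n. Qed.

(** A C^1 measure of how far [x] leaves the cube: it is 0 when all coordinates are at most [r] in
    absolute value, and at least 1 as soon as one reaches [2 * r]. *)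
Definition ramp r x :=
  \sum_j (sqpos (r^-1 * x ord0 j - 1) + sqpos (- r^-1 * x ord0 j - 1)).

Definition cutoff r x := sqpos (1 - ramp r x).

Lemma ramp_ge0 r x : 0 <= ramp r x.
Proof. by apply: sumr_ge0 => j _; rewrite addr_ge0 // sqpos_ge0. Qed.

Lemma le_ramp r x i :
  sqpos (r^-1 * x ord0 i - 1) + sqpos (- r^-1 * x ord0 i - 1) <= ramp r x.
Proof.
rewrite /ramp (bigD1 i) //= lerDl.
by apply: sumr_ge0 => j _; rewrite addr_ge0 // sqpos_ge0.
Qed.

Lemma cutoff_ge0 r x : 0 <= cutoff r x.
Proof. exact: sqpos_ge0. Qed.

Lemma cutoff_root_le1 r x : Num.max (1 - ramp r x) 0 <= 1.
Proof. by rewrite ge_max ler01 andbT gerBl ramp_ge0. Qed.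

Lemma cutoff_le1 r x : cutoff r x <= 1.
Proof.
rewrite /cutoff /sqpos expr_le1 ?cutoff_root_le1 //.
by rewrite le_max lexx orbT.
Qed.

Lemma cutoff_inside r x : 0 < r -> (forall i, `|x ord0 i| <= r) -> cutoff r x = 1.
Proof.
move=> r0 xr; rewrite /cutoff (_ : ramp r x = 0) ?subr0 /sqpos.
  by rewrite (max_idPl ler01) expr1n.
apply: big1 => j _; have := xr j; rewrite ler_norml => /andP[h1 h2].
rewrite !sqpos_le0 ?addr0 // subr_le0 ?mulNr -1?mulrN ler_pdivrMl // mulr1 //.
by rewrite lerNl.
Qed.

Lemma ramp_outside r x i : 0 < r -> 2 * r <= `|x ord0 i| -> 1 <= ramp r x.
Proof.
move=> r0 xr; apply: le_trans (le_ramp r x i).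
have E : r^-1 * r = 1 by rewrite mulVf // gt_eqF.
have r0' : 0 < r^-1 by rewrite invr_gt0.
have key (t : R) : 2 <= t -> 1 <= sqpos (t - 1).
  by move=> t2; rewrite /sqpos (_ : Num.max _ _ = t - 1); [nra|apply/max_idPl; lra].
move: xr; rewrite ler_normr => /orP[] xr.
  apply: ler_wpDr; first exact: sqpos_ge0.
  by apply: key; nra.
apply: ler_wpDl; first exact: sqpos_ge0.
by apply: key; nra.
Qed.

Lemma cutoff_outside r x i : 0 < r -> 2 * r <= `|x ord0 i| -> cutoff r x = 0.
Proof. by move=> r0 /(ramp_outside r0) h; rewrite /cutoff sqpos_le0 // subr_le0. Qed.

Lemma cutoff_vanishes r : 0 < r -> vanishes_off_cube (2 * r) (cutoff r).
Proof. by move=> r0 x i /ltW; exact: cutoff_outside. Qed.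

(** The condition [2 * r <= r'] places the support of the first cutoff where the second equals 1. *)
Lemma le_cutoff r r' x : 0 < r -> 2 * r <= r' -> cutoff r x <= cutoff r' x.
Proof.
move=> r0 rr'; have r0' : 0 < r' by lra.
have [h|/existsNP[i /negP]] := pselect (forall i, `|x ord0 i| <= r').
  by rewrite (cutoff_inside r0' h) cutoff_le1.
rewrite -ltNge => h; rewrite (@cutoff_outside r x i) ?cutoff_ge0 //.
by rewrite ltW // (le_lt_trans rr').
Qed.

Lemma C1_partial_cutoff r : C1 (cutoff r) /\ forall i x, partial i (cutoff r) x =
  - (4 * r^-1) * Num.max (1 - ramp r x) 0 *
    (Num.max (r^-1 * x ord0 i - 1) 0 - Num.max (- r^-1 * x ord0 i - 1) 0).
Proof.
have cd : continuous (fun t : R => 2 * Num.max t 0).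
  by apply: ctsM; [exact: cts_cst|exact: cts_maxr0].
have aff (c : R) j : C1 (fun x => c * x ord0 j - 1) /\
    forall i x, partial i (fun x => c * x ord0 j - 1) x = c * (i == j)%:R.
  have [Cj pj] := @C1_coord R d j.
  split; first by apply: C1D; [exact: C1Z|exact: C1_cst].
  move=> i x; rewrite partialD ?partial_cst ?addr0 ?partialZ ?pj //; first exact: C1Z.
  exact: C1_cst.
have piece (c : R) j := C1_partial_comp (@is_derive_sqpos R) cd (aff c j).1.
have Cpair j := C1D (piece r^-1 j).1 (piece (- r^-1) j).1.
have Cramp : C1 (ramp r) by exact: C1_sum.
have Cone : C1 (fun x => 1 + -1 * ramp r x) by apply: C1D; [exact: C1_cst|exact: C1Z].
have [Cc pc] := C1_partial_comp (@is_derive_sqpos R) cd Cone.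
have E : cutoff r = (fun x => sqpos (1 + -1 * ramp r x)).
  by apply/funext => x; rewrite mulN1r.
rewrite {1 2}E; split=> // i x; rewrite pc mulN1r.
rewrite partialD; [|exact: C1_cst|exact: C1Z].
rewrite partial_cst add0r partialZ // partial_sum //.
rewrite (bigD1 i) //= big1 ?addr0; last first.
  move=> j ji; rewrite partialD ?(piece _ _).2 ?(aff _ _).2; try exact: (piece _ _).1.
  by rewrite eq_sym (negbTE ji) !mulr0 addr0.
rewrite partialD ?(piece _ _).2 ?(aff _ _).2 ?eqxx ?mulr1; try exact: (piece _ _).1.
ring.
Qed.

Lemma partial_cutoff_inside r i x : 0 < r -> (forall j, `|x ord0 j| <= r) ->
  partial i (cutoff r) x = 0.
Proof.
move=> r0 xr; rewrite (C1_partial_cutoff r).2.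
have := xr i; rewrite ler_norml => /andP[h1 h2].
have -> : Num.max (r^-1 * x ord0 i - 1) 0 = 0.
  by apply/max_idPr; rewrite subr_le0 ler_pdivrMl // mulr1.
have -> : Num.max (- r^-1 * x ord0 i - 1) 0 = 0.
  by apply/max_idPr; rewrite subr_le0 mulNr -mulrN ler_pdivrMl // mulr1 lerNl.
by rewrite subrr mulr0.
Qed.

Lemma partial_cutoff_outside r i j x : 0 < r -> 2 * r <= `|x ord0 j| ->
  partial i (cutoff r) x = 0.
Proof.
move=> r0 /(ramp_outside r0) h; rewrite (C1_partial_cutoff r).2.
by rewrite (max_idPr _) ?subr_le0 // mulr0 mul0r.
Qed.

(** The last factor is the square root of the cutoff. Where [ramp r x < 1], the squares of [p] and
    [q] sum to less than 1, so [p - q] is at most 1 in absolute value; elsewhere both sides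
    vanish. *)
Lemma partial_cutoff_bound r i x : 0 < r ->
  `|partial i (cutoff r) x| <= 4 * r^-1 * Num.max (1 - ramp r x) 0.
Proof.
move=> r0; have r0' : 0 < r^-1 by rewrite invr_gt0.
rewrite (C1_partial_cutoff r).2.
have m0 : 0 <= Num.max (1 - ramp r x) 0 by rewrite le_max lexx orbT.
have [h|h] := leP 1 (ramp r x).
  by rewrite (max_idPr _) ?subr_le0 // mulr0 mul0r normr0 mulr0.
set p := Num.max (r^-1 * x ord0 i - 1) 0; set q := Num.max (- r^-1 * x ord0 i - 1) 0.
have p0 : 0 <= p by rewrite le_max lexx orbT.
have q0 : 0 <= q by rewrite le_max lexx orbT.
have pq : p ^+ 2 + q ^+ 2 < 1 by apply: le_lt_trans (le_ramp r x i) h.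
have pq1 : `|p - q| <= 1 by rewrite ler_norml; nra.
have c0 : 0 <= 4 * r^-1 * Num.max (1 - ramp r x) 0 by rewrite !mulr_ge0 // ltW.
by rewrite mulNr normrM normrN (ger0_norm c0) ler_piMr.
Qed.

(** A continuous substitute for the indicator of the region where the gradient of [cutoff r] lives.
    As a difference of two cutoffs, it turns mass on the annulus into an increment of the mass on
    cubes. *)
Definition annulus r x := cutoff (2 * r) x - cutoff (r / 2) x.

Lemma annulus_ge0 r x : 0 < r -> 0 <= annulus r x.
Proof. by move=> r0; rewrite subr_ge0; apply: le_cutoff; lra. Qed.

Lemma annulus_le1 r x : annulus r x <= 1.
Proof. by have := cutoff_le1 (2 * r) x; have := cutoff_ge0 (r / 2) x; rewrite /annulus; lra. Qed.

Lemma annulus_partial_cutoff r i x : 0 < r ->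
  partial i (cutoff r) x = 0 \/ annulus r x = 1.
Proof.
move=> r0.
have [h|/existsNP[j /negP]] := pselect (forall j, `|x ord0 j| <= r).
  by left; exact: partial_cutoff_inside.
rewrite -ltNge => xj.
have [h|/existsNP[k /negP]] := pselect (forall j, `|x ord0 j| <= 2 * r).
  right; rewrite /annulus (cutoff_inside _ h); last by lra.
  by rewrite (@cutoff_outside (r / 2) x j) ?subr0 //; lra.
by rewrite -ltNge => xk; left; apply: (@partial_cutoff_outside _ _ k) => //; exact: ltW.
Qed.

Lemma cts_cutoff r : continuous (cutoff r).
Proof. by have [[]] := C1_partial_cutoff r. Qed.

Lemma cts_annulus r : continuous (annulus r).
Proof. by apply: ctsB; exact: cts_cutoff. Qed.

Lemma annulus_vanishes r : 0 < r -> vanishes_off_cube (4 * r) (annulus r).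
Proof.
move=> r0 x i xi; rewrite /annulus (@cutoff_outside _ _ i) ?(@cutoff_outside (r / 2) _ i) ?subrr //; lra.
Qed.

End cutoff.

(** * Young's inequality and increments of bounded sequences *)

Section growth.
Variable R : realType.

(** Split at [u = eta * s ^+ n.-1]. Below it the last term dominates; above it [s] is at most the
    (n-1)-th root of [u / eta], and the exponent is 1 + 1 / (n - 1) = n / (n - 1). *)
Lemma young_scaled (n : nat) (u s eta : R) : (2 <= n)%N -> 0 <= u -> 0 < s -> 0 < eta ->
  u * s <= (eta^-1) `^ (n%:R - 1)^-1 * u `^ (n%:R / (n%:R - 1)) + eta * s ^+ n.
Proof.
move=> n2 u0 s0 eta0.
have n1 : 0 < n%:R - 1 :> R by rewrite subr_gt0 ltr1n.
have [us|us] := leP u (eta * s ^+ n.-1).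
  apply: ler_wpDl; first by rewrite mulr_ge0 ?powR_ge0.
  by rewrite -{1}(prednK (ltnW n2)) exprSr mulrA ler_wpM2r // ltW.
apply: ler_wpDr; first by rewrite mulr_ge0 ?exprn_ge0 // ltW.
have u1 : 0 < u by apply: le_lt_trans us; rewrite mulr_ge0 ?exprn_ge0 // ltW.
have -> : n%:R / (n%:R - 1) = 1 + (n%:R - 1)^-1 :> R.
  by field; rewrite gt_eqF.
rewrite powRD; last by apply/implyP => _; rewrite gt_eqF.
rewrite powRr1 // mulrCA ler_wpM2l // -powRM ?invr_ge0 ?ltW //.
have -> : s = (s `^ (n%:R - 1)) `^ (n%:R - 1)^-1.
  by rewrite -powRrM mulfV ?gt_eqF // powRr1 // ltW.
apply: gt0_ltr_powR; rewrite ?invr_gt0 ?nnegrE ?powR_ge0 //.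
  by rewrite mulr_ge0 // invr_ge0 ltW.
have -> : n%:R - 1 = n.-1%:R :> R by rewrite -subn1 natrB // ltnW.
by rewrite powR_mulrn ?(ltW s0) // ltr_pdivlMl.
Qed.

(** Steps of size at least [e] from [N] on would add up past [B]. This serves as the smallness of a
    tail: a single good scale beyond [N] is enough. *)
Lemma bounded_increasing_small_step (a : nat -> R) (B e : R) (N : nat) :
  0 < e -> (forall n, a n <= B) ->
  exists2 n, (N <= n)%N & a n.+1 - a n < e.
Proof.
move=> e0 aB; apply: contrapT => /forall2NP h.
have step n : a N + n%:R * e <= a (N + n)%N.
  elim: n => [|n IH]; first by rewrite mul0r addr0 addn0.
  have [//|/negP] := h (N + n)%N; first by rewrite leq_addr.
  by rewrite -leNgt addnS -natr1; lra.
have [n nB] : exists n : nat, (B - a N) / e < n%:R.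
  by exists (Num.truncn ((B - a N) / e)).+1; exact: truncnS_gt.
move: nB; rewrite ltr_pdivrMr // => nB.
by have := step n; have := aB (N + n)%N; lra.
Qed.

End growth.

(** * Liouville argument for an abstract flux [F], dissipation [W] and speed [u] *)

Section liouville.
Variables (R : realType) (d : nat).
Implicit Types (x : 'rV[R]_d) (r : R).
Variables (F : 'I_d -> 'rV[R]_d -> R) (W u : 'rV[R]_d -> R) (k C : R).
Hypothesis d2 : (2 <= d)%N.
Hypothesis CF : forall i, C1 (F i).
Hypothesis cW : continuous W.
Hypothesis W0 : forall x, 0 <= W x.
Hypothesis cu : continuous u.
Hypothesis u0 : forall x, 0 <= u x.
Hypothesis k0 : 0 < k.
Hypothesis C0 : 0 <= C.
Hypothesis divF : forall x, \sum_i partial i (F i) x <= - k * W x.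
Hypothesis boundF : forall i x,
  `|F i x| <= C * (u x + u x ^+ 3 + u x * Num.sqrt (W x)).

(** [4 * C] bounds the terms in [u] and [u ^+ 3]; the second summand is the price of absorbing
    [u * Num.sqrt (W x)] with weight [k / (2 * d%:R)]. Summed over the [d] directions, that weight
    uses up half of [k * W]. *)
Let c := 4 * C + 8 * d%:R * C ^+ 2 / k.

Let c_ge0 : 0 <= c.
Proof. by rewrite addr_ge0 ?mulr_ge0 ?sqr_ge0 ?invr_ge0 // ltW. Qed.

Let cutoff_flux_bound r i x : 1 <= r ->
  F i x * partial i (cutoff r) x <=
  k / (2 * d%:R) * (cutoff r x * W x) + c * (annulus r x * ((u x + u x ^+ 3) / r)).
Proof.
move=> r1; have r0 : 0 < r by apply: lt_le_trans r1.
have d0 : 0 < d%:R :> R by rewrite ltr0n ltnW.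
have c1_ge0 : 0 <= k / (2 * d%:R) by rewrite divr_ge0 ?mulr_ge0 ?ltW.
have uu0 : 0 <= (u x + u x ^+ 3) / r by rewrite divr_ge0 ?addr_ge0 ?exprn_ge0 // ltW.
case: (annulus_partial_cutoff i x r0) => [->|->].
  rewrite mulr0 addr_ge0 // mulr_ge0 // mulr_ge0 ?cutoff_ge0 ?annulus_ge0 //.
rewrite mul1r; apply: le_trans (ler_norm _) _; rewrite normrM.
have := boundF i x; have := partial_cutoff_bound i x r0.
set g := `|partial i _ x|; set f := `|F i x|; set m := Num.max _ 0 => gm fC.
have m0 : 0 <= m by rewrite /m le_max lexx orbT.
have m1 : m <= 1 by exact: cutoff_root_le1.
have -> : cutoff r x = m ^+ 2 by [].
set w := Num.sqrt (W x) in fC *.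
have -> : W x = w ^+ 2 by rewrite sqr_sqrtr.
have w0 : 0 <= w by exact: sqrtr_ge0.
have s0 : 0 < r^-1 by rewrite invr_gt0.
have s1 : r^-1 <= 1 by rewrite invf_le1.
move: gm fC s0 s1 uu0 (u0 x); set s := r^-1; set U := u x => gm fC s0 s1 uu0 U0.
have U3 : 0 <= U ^+ 3 by rewrite exprn_ge0.
apply: (@le_trans _ _ (C * (U + U ^+ 3 + U * w) * (4 * s * m))).
  by apply: ler_pM; rewrite ?normr_ge0.
have -> : C * (U + U ^+ 3 + U * w) * (4 * s * m) =
   4 * C * m * ((U + U ^+ 3) * s) + (m * w) * (4 * C * s * U) by ring.
have h1 : 4 * C * m * ((U + U ^+ 3) * s) <= 4 * C * ((U + U ^+ 3) * s).
  by rewrite ler_wpM2r // ler_piMr // mulr_ge0.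
(* Completing the square, with [m] the square root of the cutoff and [w] that of the dissipation. *)
have h2 : (m * w) * (4 * C * s * U) <=
    k / (2 * d%:R) * (m ^+ 2 * w ^+ 2) + 8 * d%:R * C ^+ 2 / k * (s ^+ 2 * U ^+ 2).
  rewrite -subr_ge0.
  have -> : k / (2 * d%:R) * (m ^+ 2 * w ^+ 2)
     + 8 * d%:R * C ^+ 2 / k * (s ^+ 2 * U ^+ 2) - m * w * (4 * C * s * U)
     = (2 * d%:R * k)^-1 * (k * (m * w) - 4 * d%:R * C * s * U) ^+ 2.
    by field; rewrite !gt_eqF.
  by rewrite mulr_ge0 ?sqr_ge0 ?invr_ge0 ?mulr_ge0 ?ltW.
(* This is where [1 <= r] matters, through [s ^+ 2 <= s]. *)
have h3 : s ^+ 2 * U ^+ 2 <= (U + U ^+ 3) * s.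
  have hU : U ^+ 2 <= U + U ^+ 3.
    rewrite -subr_ge0 (_ : _ - _ = U * ((U - 1) ^+ 2 + U)); last by ring.
    by rewrite mulr_ge0 ?addr_ge0 ?sqr_ge0.
  have hs : s ^+ 2 <= s by rewrite expr2 ler_piMl // ltW.
  by rewrite mulrC; apply: ler_pM; rewrite ?sqr_ge0.
have h4 : 8 * d%:R * C ^+ 2 / k * (s ^+ 2 * U ^+ 2) <=
          8 * d%:R * C ^+ 2 / k * ((U + U ^+ 3) * s).
  apply: ler_wpM2l => //; rewrite mulr_ge0 ?invr_ge0 ?(ltW k0) //.
  by rewrite mulr_ge0 ?sqr_ge0 // mulr_ge0 // ltW.
have -> : c * ((U + U ^+ 3) * s) =
   4 * C * ((U + U ^+ 3) * s) + 8 * d%:R * C ^+ 2 / k * ((U + U ^+ 3) * s).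
  by rewrite /c mulrDl.
have := lerD h1 (le_trans h2 (lerD (lexx _) h4)).
by move=> /le_trans; apply; rewrite addrCA.
Qed.

(** The product rule for [cutoff r * F], kept pointwise: the divergence on the right integrates to
    0. *)
Let caccioppoli r x : 1 <= r ->
  k / 2 * (cutoff r x * W x) <=
  d%:R * c * (annulus r x * ((u x + u x ^+ 3) / r))
  - \sum_i partial i (fun y => cutoff r y * F i y) x.
Proof.
move=> r1; have [Cc _] := @C1_partial_cutoff R d r.
have d0 : 0 < d%:R :> R by rewrite ltr0n ltnW.
under eq_bigr do rewrite partialM //.
rewrite big_split /= -mulr_sumr.
have : \sum_i F i x * partial i (cutoff r) x <= \sum_(i < d)
   (k / (2 * d%:R) * (cutoff r x * W x) + c * (annulus r x * ((u x + u x ^+ 3) / r))).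
  by apply: ler_sum => i _; exact: cutoff_flux_bound.
rewrite sumr_const card_ord -[_ *+ d]mulr_natl mulrDr.
have -> : d%:R * (k / (2 * d%:R) * (cutoff r x * W x)) = k / 2 * (cutoff r x * W x).
  by field; rewrite gt_eqF.
have h := ler_wpM2l (cutoff_ge0 r x) (divF x).
set S := \sum_i F i x * _; set T := \sum_i _ in h *.
set X := annulus r x * _; set Z := cutoff r x * W x => hS.
have hZ : cutoff r x * (- k * W x) = - (k * Z) by rewrite /Z; ring.
rewrite hZ in h; rewrite -[d%:R * c * X]mulrA; set Q := d%:R * (c * X) in hS *.
have hk : k * Z = k / 2 * Z + k / 2 * Z by field.
by rewrite hk in h; move: h hS; set kZ := k / 2 * Z; lra.
Qed.

Let p : R := d%:R / (d%:R - 1).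
Let G x := u x `^ p + u x `^ (3 * p).
Hypothesis up : (Rd_integral (fun x => (u x `^ p)%:E) < +oo)%E.
Hypothesis u3p : (Rd_integral (fun x => (u x `^ (3 * p))%:E) < +oo)%E.

Let p_gt0 : 0 < p.
Proof. by rewrite divr_gt0 ?subr_gt0 ?ltr1n // ltr0n ltnW. Qed.

Let cts_upow q : 0 < q -> continuous (fun x => u x `^ q).
Proof.
move=> q0; rewrite (_ : (fun x => _) = (fun x => `|u x| `^ q)); last first.
  by apply/funext => x; rewrite ger0_norm.
move=> x; apply: (@continuous_comp _ _ _ u (fun t : R => `|t| `^ q)).
  exact: cu.
exact: cts_norm_powR.
Qed.

Let cG : continuous G.
Proof. by apply: ctsD; apply: cts_upow => //; rewrite mulr_gt0. Qed.

Let mass_bounded : exists B, forall r, 0 < r ->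
  cube_integral (fun x => cutoff r x * G x) <= B.
Proof.
have part q : 0 < q -> (Rd_integral (fun x => (u x `^ q)%:E) < +oo)%E ->
    exists B, forall r, 0 < r -> cube_integral (fun x => cutoff r x * u x `^ q) <= B.
  move=> q0 fin; exists (fine (Rd_integral (fun x => (u x `^ q)%:E))) => r r0.
  have le : ((cube_integral (fun x => cutoff r x * u x `^ q))%:E <=
             Rd_integral (fun x => (u x `^ q)%:E))%E.
    apply: (@le_cube_integral_Rd_integral _ _ (2 * r)).
    - by rewrite mulr_ge0 // ltW.
    - by apply: ctsM; [exact: cts_cutoff|exact: cts_upow].
    - by move=> x i /(cutoff_vanishes r0) ->; rewrite mul0r.
    - by move=> x; rewrite mulr_ge0 ?cutoff_ge0 ?powR_ge0.
    - by move=> x; rewrite ler_piMl ?cutoff_le1 ?powR_ge0.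
  rewrite -lee_fin fineK // ge0_fin_numE //.
  apply: le_trans le; rewrite lee_fin; apply: iter_Rintegral_ge0 => y.
  by rewrite mulr_ge0 ?cutoff_ge0 ?powR_ge0.
have p30 : 0 < 3 * p by rewrite mulr_gt0.
have [B1 h1] := part _ p_gt0 up; have [B2 h2] := part _ p30 u3p.
exists (B1 + B2) => r r0.
rewrite (_ : (fun x => _) = (fun x => cutoff r x * u x `^ p + cutoff r x * u x `^ (3 * p))).
  rewrite (@cube_integralD _ _ (2 * r)) ?lerD ?h1 ?h2 //.
  - by rewrite mulr_ge0 // ltW.
  - by apply: ctsM; [exact: cts_cutoff|exact: cts_upow].
  - by move=> x i /(cutoff_vanishes r0) ->; rewrite mul0r.
  - by apply: ctsM; [exact: cts_cutoff|exact: cts_upow].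
  - by move=> x i /(cutoff_vanishes r0) ->; rewrite mul0r.
by apply/funext => x; rewrite mulrDr.
Qed.

(** Young's inequality with [s = r^-1] is applied to [u] and to [u ^+ 3]; their p-th powers are the
    two summands of [G]. *)
Let young_growth eta x r : 0 < eta -> 0 < r ->
  (u x + u x ^+ 3) / r <= (eta^-1) `^ (d%:R - 1)^-1 * G x + 2 * (eta * r^-1 ^+ d).
Proof.
move=> eta0 r0; have s0 : 0 < r^-1 by rewrite invr_gt0.
have h1 := young_scaled d2 (u0 x) s0 eta0.
have h2 := young_scaled d2 (exprn_ge0 3 (u0 x)) s0 eta0.
have e3 : (u x ^+ 3) `^ p = u x `^ (3 * p) by rewrite -powR_mulrn // -powRrM.
rewrite -/p in h1 h2; rewrite e3 in h2; have := lerD h1 h2.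
have -> : (u x + u x ^+ 3) / r = u x / r + u x ^+ 3 / r by rewrite mulrDl.
move=> /le_trans; apply; rewrite /G le_eqVlt; apply/orP; left; apply/eqP.
by ring.
Qed.

(** The annulus lies in a cube of side [8 * r], whose volume cancels [r^-1 ^+ d] and leaves
    [8 ^+ d], independent of [r]. *)
Let cutoff_energy_bound r eta : 1 <= r -> 0 < eta ->
  k / 2 * cube_integral (fun x => cutoff r x * W x) <=
  d%:R * c * ((eta^-1) `^ (d%:R - 1)^-1 *
      (cube_integral (fun x => cutoff (2 * r) x * G x)
        - cube_integral (fun x => cutoff (r / 2) x * G x))
    + 2 * (eta * 8 ^+ d)).
Proof.
move=> r1 eta0; have r0 : 0 < r by apply: lt_le_trans r1.
pose K := (eta^-1) `^ (d%:R - 1)^-1; rewrite -/K.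
have r4 : 0 <= 4 * r by rewrite mulr_ge0 // ltW.
have le24 : 2 * r <= 4 * r by lra.
have c2 := vanishes_off_cubeW le24 (@cutoff_vanishes R d r r0).
have le44 : 2 * (2 * r) <= 4 * r by lra.
have c4 : vanishes_off_cube (4 * r) (@cutoff R d (2 * r)).
  by apply: (vanishes_off_cubeW le44); apply: cutoff_vanishes; lra.
have le14 : 2 * (r / 2) <= 4 * r by lra.
have c1 : vanishes_off_cube (4 * r) (@cutoff R d (r / 2)).
  by apply: (vanishes_off_cubeW le14); apply: cutoff_vanishes; lra.
have van (f g : 'rV[R]_d -> R) : vanishes_off_cube (4 * r) f ->
    vanishes_off_cube (4 * r) (fun x => f x * g x).
  by move=> f0 x i /f0 ->; rewrite mul0r.
have ca := @annulus_vanishes R d r r0.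
have dc0 : 0 <= d%:R * c by rewrite mulr_ge0.
pose D x := \sum_i partial i (fun y => cutoff r y * F i y) x.
have Cp i : C1 (fun y => cutoff r y * F i y).
  by apply: C1M => //; case: (@C1_partial_cutoff R d r).
have Dvan i : vanishes_off_cube (4 * r) (partial i (fun y => cutoff r y * F i y)).
  move=> x j xj; rewrite partialM //; last by case: (@C1_partial_cutoff R d r).
  rewrite (c2 x j xj) mul0r (@partial_cutoff_outside _ _ _ _ j) ?mulr0 ?addr0 //.
  by rewrite ltW // (le_lt_trans le24).
have cD : continuous D by apply: cts_sum => i; have [_ /(_ i)[]] := Cp i.
have vD : vanishes_off_cube (4 * r) D.
  by move=> x j xj; apply: big1 => i _; exact: Dvan xj.
have ID : cube_integral D = 0.
  (* The induction over directions carries continuity and support along, since additivity of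
     [cube_integral] requires both. *)
  have : forall s : seq 'I_d, cube_integral
      (fun x => \sum_(i <- s) partial i (fun y => cutoff r y * F i y) x) = 0
      /\ continuous (fun x => \sum_(i <- s) partial i (fun y => cutoff r y * F i y) x)
      /\ vanishes_off_cube (4 * r) (fun x => \sum_(i <- s) partial i (fun y => cutoff r y * F i y) x).
    elim=> [|i s [I1 [I2 I3]]].
      under eq_fun do rewrite big_nil.
      split; last by split; [exact: cts_cst|].
      have := @cube_integralZ R d (4 * r) 0 (fun=> 0) r4 (@cts_cst _ _ 0) (fun _ _ _ => erefl).
      by rewrite mulr0 mul0r.
    under eq_fun do rewrite big_cons.
    have [ci di] := Cp i; have [dii cii] := di i.
    split; [|split].
    - rewrite (@cube_integralD _ _ (4 * r)) // I1 addr0.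
      by apply: (@cube_integral_partial _ _ (4 * r)) => //; exact: van.
    - exact: ctsD.
    - by move=> x j xj; rewrite (Dvan i x j xj) (I3 x j xj) addr0.
  by move=> /(_ (index_enum _))[].
pose e := 2 * (eta * r^-1 ^+ d).
have e0 : 0 <= e by rewrite !mulr_ge0 ?exprn_ge0 ?invr_ge0 // ltW.
have pw x : k / 2 * (cutoff r x * W x) <=
   d%:R * c * (K * (annulus r x * G x) + e * annulus r x) - D x.
  apply: le_trans (caccioppoli x r1) _; rewrite lerD2r ler_wpM2l //.
  apply: (le_trans (ler_wpM2l (annulus_ge0 x r0) (young_growth x eta0 r0))).
  by rewrite -/K -/e mulrDr mulrCA (mulrC e).
have cA := @cts_annulus R d r.
have cAG : continuous (fun x => annulus r x * G x) by exact: ctsM.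
have cKA : continuous (fun x => K * (annulus r x * G x)) by apply: ctsM => //; exact: cts_cst.
have ceA : continuous (fun x => e * annulus r x) by apply: ctsM => //; exact: cts_cst.
have vKA : vanishes_off_cube (4 * r) (fun x => K * (annulus r x * G x)).
  by move=> x i /ca ->; rewrite mul0r mulr0.
have veA : vanishes_off_cube (4 * r) (fun x => e * annulus r x).
  by move=> x i /ca ->; rewrite mulr0.
have cS := ctsD cKA ceA.
have vS : vanishes_off_cube (4 * r) (fun x => K * (annulus r x * G x) + e * annulus r x).
  by move=> x i xi; rewrite (vKA x i) // (veA x i) // addr0.
have cdS : continuous (fun x => d%:R * c * (K * (annulus r x * G x) + e * annulus r x)).
  by apply: ctsM => //; exact: cts_cst.
have vdS : vanishes_off_cube (4 * r) (fun x => d%:R * c * (K * (annulus r x * G x) + e * annulus r x)).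
  by move=> x i xi; rewrite (vS x i) // mulr0.
have cCW : continuous (fun x => cutoff r x * W x) by apply: ctsM => //; exact: cts_cutoff.
rewrite -(@cube_integralZ _ _ (4 * r)) //; last exact: van.
apply: (@le_trans _ _ (cube_integral (fun x =>
   d%:R * c * (K * (annulus r x * G x) + e * annulus r x) - D x))).
  apply: (@le_cube_integral _ _ (4 * r)) => //.
  - by apply: ctsM => //; exact: cts_cst.
  - by move=> x i /c2 ->; rewrite mul0r mulr0.
  - exact: ctsB.
  - by move=> x i xi; rewrite (vdS x i) // (vD x i) // subr0.
rewrite (@cube_integralB _ _ (4 * r)) // ID subr0.
rewrite (@cube_integralZ _ _ (4 * r)) // (@cube_integralD _ _ (4 * r)) //.
rewrite (@cube_integralZ _ _ (4 * r)) //; last exact: van.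
rewrite (@cube_integralZ _ _ (4 * r)) // ler_wpM2l //; apply: lerD.
  rewrite -(@cube_integralB _ _ (4 * r)) //; last 4 first.
  - by apply: ctsM => //; exact: cts_cutoff.
  - exact: van.
  - by apply: ctsM => //; exact: cts_cutoff.
  - exact: van.
  rewrite (_ : (fun x => annulus r x * G x) =
     (fun x => cutoff (2 * r) x * G x - cutoff (r / 2) x * G x)) //.
  by apply/funext => x; rewrite mulrBl.
have bA : `|cube_integral (@annulus R d r)| <= 1 * (4 * r *+ 2) ^+ d.
  apply: cube_integral_bound => // x; rewrite ger0_norm ?annulus_ge0 //.
  exact: annulus_le1.
apply: (@le_trans _ _ (e * (1 * (4 * r *+ 2) ^+ d))).
  by rewrite ler_wpM2l // (le_trans (ler_norm _)).
rewrite mul1r /e -mulrA -mulrA -exprMn.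
by rewrite (_ : r^-1 * (4 * r *+ 2) = 8) //; field; rewrite gt_eqF.
Qed.

(** The order of limits matters: for fixed [eta] a scale is chosen where the mass increment is
    small, which gives [main]; only then is [eta] made small. *)
Lemma liouville_flux x : W x = 0.
Proof.
apply/eqP; apply/negPn/negP => Wx.
have {}Wx : 0 < W x by rewrite lt_neqAle eq_sym Wx W0.
have [B hB] := mass_bounded.
pose r0 := `|x| + 1.
have r00 : 0 < r0 by rewrite ltr_wpDl.
have vW r : 0 < r -> vanishes_off_cube (2 * r) (fun x => cutoff r x * W x).
  by move=> r1 y i /(cutoff_vanishes r1) ->; rewrite mul0r.
have cCW r : continuous (fun x => cutoff r x * W x) by apply: ctsM => //; exact: cts_cutoff.
have L0 : 0 < cube_integral (fun x => cutoff r0 x * W x).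
  apply: (@cube_integral_gt0 _ _ (2 * r0) _ x) => //.
  - by rewrite mulr_ge0 // ltW.
  - exact: vW.
  - by move=> z; rewrite mulr_ge0 ?cutoff_ge0.
  - rewrite cutoff_inside ?mul1r // => i.
    by apply: le_trans (coord_le_row_norm x i) _; rewrite lerDl.
set L := cube_integral _ in L0.
have kL : 0 < k / 2 * L by rewrite mulr_gt0 // divr_gt0.
have dc0 : 0 <= d%:R * c by rewrite mulr_ge0.
have main eta : 0 < eta -> k / 2 * L <= d%:R * c * (2 * (eta * 8 ^+ d)).
  move=> eta0; apply/ler_addgt0Pr => e e0.
  pose K := (eta^-1) `^ (d%:R - 1)^-1.
  have K0 : 0 <= K by exact: powR_ge0.
  have M0 : 0 < d%:R * c * K + 1 by rewrite ltr_wpDl // mulr_ge0.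
  (* At radius [2 * 4 ^+ n] the two cutoffs of the annulus have radii [4 ^+ n.+1] and [4 ^+ n], so
     its mass is one increment of [a]. *)
  pose a n := cube_integral (fun x => cutoff (4 ^+ n) x * G x).
  have [N NP] : exists N, 2 * r0 <= 2 * 4 ^+ N.
    exists (Num.truncn r0).+1 => //; rewrite ler_pM2l //.
    apply: le_trans (ltW (truncnS_gt r0)) _.
    by rewrite -natrX ler_nat ltnW // ltn_expl.
  have aB n : a n <= B by apply: hB; rewrite exprn_gt0.
  have [n Nn an] := bounded_increasing_small_step N (divr_gt0 e0 M0) aB.
  have rn : 2 * r0 <= 2 * 4 ^+ n.
    by apply: le_trans NP _; rewrite ler_pM2l // ler_eXn2l // ltr1n.
  have r1 : 1 <= 2 * 4 ^+ n :> R.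
    by have : 1 <= 4 ^+ n :> R; [apply: exprn_ege1; rewrite ler1n|lra].
  have := cutoff_energy_bound r1 eta0.
  rewrite (_ : 2 * (2 * 4 ^+ n) = 4 ^+ n.+1); last by rewrite exprS; ring.
  rewrite (_ : 2 * 4 ^+ n / 2 = 4 ^+ n); last by field.
  rewrite -/K -/(a n) -/(a n.+1) => h.
  have hL : k / 2 * L <= k / 2 * cube_integral (fun x => cutoff (2 * 4 ^+ n) x * W x).
    apply: ler_wpM2l; first by rewrite divr_ge0 ?(ltW k0).
    have r20 : 0 < 2 * 4 ^+ n :> R by apply: lt_le_trans r1.
    have le1 : 2 * r0 <= 2 * (2 * 4 ^+ n) by lra.
    apply: (@le_cube_integral _ _ (2 * (2 * 4 ^+ n))) => //.
    - exact: (vanishes_off_cubeW le1 (vW _ r00)).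
    - exact: vW.
    - by move=> y; rewrite ler_wpM2r // le_cutoff.
  apply: (le_trans (le_trans hL h)); rewrite mulrDr addrC lerD2l mulrA.
  have : d%:R * c * K * (a n.+1 - a n) <= d%:R * c * K * (e / (d%:R * c * K + 1)).
    by apply: ler_wpM2l; [rewrite mulr_ge0|exact: ltW].
  move=> /le_trans; apply; rewrite mulrA ler_pdivrMr // mulrC ler_wpM2l ?ltW //.
  by rewrite ltrDl.
have Q0 : 0 < 4 * (d%:R * c + 1) * 8 ^+ d :> R.
  by rewrite !mulr_gt0 ?exprn_gt0 // ltr_wpDl.
(* With this [eta] the right side of [main] is [M / (M + 1)] times half of the left side; [M + 1]
   covers the case [M = 0]. *)
have := main _ (divr_gt0 kL Q0); apply/negP; rewrite -ltNge.
set M := d%:R * c in dc0 Q0 *; set E := 8 ^+ d in Q0 *; set X := k / 2 * L in kL *.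
have E0 : 0 < E by rewrite exprn_gt0.
have M1 : 0 < M + 1 by rewrite ltr_wpDl.
have -> : M * (2 * (X / (4 * (M + 1) * E) * E)) = (M / (M + 1)) * (X / 2).
  by field; rewrite !gt_eqF.
have : M / (M + 1) <= 1 by rewrite ler_pdivrMr // mul1r lerDl.
by nra.
Qed.

End liouville.

Opaque partial.

(** Every point is reached from 0 by steps along the axes, and by the mean value theorem no step
    changes [f]; a negative step is a positive one read backwards. *)
Lemma zero_partials_cst (R : realType) (d : nat) (f : 'rV[R]_d -> R) : C1 f ->
  (forall i x, partial i f x = 0) -> forall x, f x = f 0.
Proof.
move=> Cf f0.
have pos i x (h : R) : 0 <= h -> f (x + h *: delta_mx 0 i) = f x.
  move=> h0; have [_ /(_ i)[df _]] := Cf.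
  have [c _] := partial_MVT x h0 df.
  by rewrite f0 mul0r => /eqP; rewrite subr_eq0 => /eqP.
have line i x (h : R) : f (x + h *: delta_mx 0 i) = f x.
  have [h0|h0] := leP 0 h; first exact: pos.
  rewrite -(pos i (x + h *: delta_mx 0 i) (- h)) ?oppr_ge0 ?ltW //.
  by rewrite scaleNr addrK.
move=> x; rewrite (row_sum_delta x).
elim: (index_enum _) => [|i s IH]; first by rewrite big_nil.
by rewrite big_cons addrC line.
Qed.

Lemma C1_partialD5 (R : realType) (d : nat) (f1 f2 f3 f4 f5 : 'rV[R]_d -> R) :
  C1 f1 -> C1 f2 -> C1 f3 -> C1 f4 -> C1 f5 ->
  C1 (fun y => f1 y + f2 y + f3 y + f4 y + f5 y) /\
  forall i x, partial i (fun y => f1 y + f2 y + f3 y + f4 y + f5 y) x =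
    partial i f1 x + partial i f2 x + partial i f3 x + partial i f4 x + partial i f5 x.
Proof.
move=> C1f C2f C3f C4f C5f.
have C12 := C1D C1f C2f; have C13 := C1D C12 C3f; have C14 := C1D C13 C4f.
split; first exact: (C1D C14 C5f).
move=> i x; rewrite (partialD i x C14 C5f) (partialD i x C13 C4f).
by rewrite (partialD i x C12 C3f) (partialD i x C1f C2f).
Qed.

(** * The local energy identity and bounds on its flux *)

Section energy_flux.
Variables (R : realType) (d : nat) (mu A gamma a b : R).
Variables (rho : 'rV[R]_d -> R) (v : 'rV[R]_d -> 'rV[R]_d).
Implicit Types (x : 'rV[R]_d) (i j : 'I_d).
Local Notation V j := (vcomp v j).
Local Notation P := (fun y => A * rho y `^ gamma).
Local Notation D := (fun y => \sum_i partial i (V i) y).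
Hypothesis gamma1 : 1 < gamma.
Hypothesis rho0 : forall x, 0 <= rho x.
Hypothesis srho : smooth rho.
Hypothesis sv : forall j, smooth (V j).
Hypothesis continuity : forall x, \sum_i partial i (fun y => rho y * V i y) x = 0.
Hypothesis momentum : forall j x,
  \sum_i partial i (fun y => rho y * V i y * V j y) x =
  - partial j P x + mu * (\sum_i partial i (partial i (V j)) x)
  + (a - b) * partial j D x.

Let Crho : C1 rho. Proof. exact: smooth_C1. Qed.
Let CV j : C1 (V j). Proof. exact: smooth_C1. Qed.
Let CdV i j : C1 (partial i (V j)).
Proof. by apply: smooth_C1; exact: smooth_partial. Qed.
Let CrhoV i : C1 (fun y => rho y * V i y).
Proof. exact: (C1M Crho (CV i)). Qed.
Let CVV : C1 (fun x => \sum_j V j x * V j x).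
Proof. exact: (C1_sum (fun j => C1M (CV j) (CV j))). Qed.
Let CD : C1 D. Proof. exact: (C1_sum (fun i => CdV i i)). Qed.

Let gamma_gt0 : 0 < gamma. Proof. exact: lt_trans gamma1. Qed.

Lemma C1_partial_pressure : C1 P /\ forall i x,
  partial i P x = A * (gamma * rho x `^ (gamma - 1) * partial i rho x).
Proof.
have c1 : continuous (fun t : R => gamma * `|t| `^ (gamma - 1)).
  by apply: ctsM; [exact: cts_cst|apply: cts_norm_powR; rewrite subr_gt0].
have [Cp pp] := C1_partial_comp (is_derive_odd_powR gamma1) c1 Crho.
have E : P = (fun y => A * (rho y * `|rho y| `^ (gamma - 1))).
  by apply/funext => y; rewrite ger0_norm // mulr_powRB1.
rewrite E; split; first exact: C1Z.
by move=> i x; rewrite partialZ // pp ger0_norm.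
Qed.

Let CP : C1 P. Proof. by case: C1_partial_pressure. Qed.

(** In order: kinetic energy, enthalpy, viscous work, and the work of grad (div v) in two forms, v
    (div v) with weight [a] and (v . grad) v with weight [b]. *)
Definition energy_flux i x :=
  2^-1 * (rho x * V i x * \sum_j V j x * V j x)
  + gamma / (gamma - 1) * (P x * V i x)
  + - mu * (\sum_j V j x * partial i (V j) x)
  + - a * (V i x * D x)
  + b * (\sum_j V j x * partial j (V i) x).

Definition dissipation x := \sum_i \sum_j partial i (V j) x ^+ 2.

Let Ckin i : C1 (fun x => rho x * V i x * \sum_j V j x * V j x).
Proof. exact: (C1M (CrhoV i) CVV). Qed.
Let CPV i : C1 (fun x => P x * V i x). Proof. exact: (C1M CP (CV i)). Qed.
Let Cvisc i : C1 (fun x => \sum_j V j x * partial i (V j) x).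
Proof. exact: (C1_sum (fun j => C1M (CV j) (CdV i j))). Qed.
Let CVD i : C1 (fun x => V i x * D x). Proof. exact: (C1M (CV i) CD). Qed.
Let Cconv i : C1 (fun x => \sum_j V j x * partial j (V i) x).
Proof. exact: (C1_sum (fun j => C1M (CV j) (CdV j i))). Qed.

Let flux_sum i := C1_partialD5 (C1Z 2^-1 (Ckin i)) (C1Z (gamma / (gamma - 1)) (CPV i))
  (C1Z (- mu) (Cvisc i)) (C1Z (- a) (CVD i)) (C1Z b (Cconv i)).

Lemma C1_energy_flux i : C1 (energy_flux i).
Proof. exact: (flux_sum i).1. Qed.

(** The continuity equation is used on both sides, each of which reduces to the sum of [V j x * (rho
    x * V i x * partial i (V j) x)]. *)
Let div_kinetic x :
  \sum_i partial i (fun x => 2^-1 * (rho x * V i x * \sum_j V j x * V j x)) x =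
  \sum_j V j x * \sum_i partial i (fun y => rho y * V i y * V j y) x.
Proof.
transitivity (\sum_i \sum_j V j x * (rho x * V i x * partial i (V j) x)).
  have E i : partial i (fun x => 2^-1 * (rho x * V i x * \sum_j V j x * V j x)) x =
      \sum_j V j x * (rho x * V i x * partial i (V j) x)
      + 2^-1 * (\sum_j V j x * V j x) * partial i (fun y => rho y * V i y) x.
    rewrite (partialZ _ _ _ (Ckin i)) (partialM _ _ (CrhoV i) CVV).
    rewrite mulrDr mulrA; congr (_ + _); last by rewrite mulrA.
    rewrite (partial_sum _ _ (fun j => C1M (CV j) (CV j))) !mulr_sumr.
    by apply: eq_bigr => j _; rewrite (partialM _ _ (CV j) (CV j)); field.
  under eq_bigr do rewrite E.
  by rewrite big_split /= -mulr_sumr continuity mulr0 addr0.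
rewrite exchange_big /=; apply: eq_bigr => j _.
under [in RHS]eq_bigr => i _ do rewrite (partialM _ _ (CrhoV i) (CV j)).
rewrite [in RHS]big_split /= -[X in _ * (_ + X)]mulr_sumr continuity mulr0 addr0.
by rewrite mulr_sumr.
Qed.

Let div_pressure x :
  \sum_i partial i (fun x => gamma / (gamma - 1) * (P x * V i x)) x =
  \sum_j V j x * partial j P x.
Proof.
have g1 : gamma - 1 != 0 by rewrite gt_eqF // subr_gt0.
have [_ dP] := C1_partial_pressure.
(* Continuity reads v . grad rho = - rho D. The factor gamma / (gamma - 1) then turns P D + v . grad
   P = (1 - gamma) P D back into v . grad P. *)
have N : \sum_j V j x * partial j P x = - gamma * (P x * D x).
  have := continuity x; under eq_bigr => i _ do rewrite (partialM _ _ Crho (CV i)).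
  rewrite big_split /= -mulr_sumr => /eqP; rewrite addrC addr_eq0 => /eqP E.
  transitivity (A * gamma * rho x `^ (gamma - 1) * \sum_i V i x * partial i rho x).
    by rewrite mulr_sumr; apply: eq_bigr => i _; rewrite dP; ring.
  by rewrite E -(mulr_powRB1 (rho0 x) gamma_gt0); ring.
have Ei i : partial i (fun x => gamma / (gamma - 1) * (P x * V i x)) x =
    gamma / (gamma - 1) * (P x * partial i (V i) x + V i x * partial i P x).
  by rewrite (partialZ _ _ _ (CPV i)) (partialM _ _ CP (CV i)).
under eq_bigr do rewrite Ei.
by rewrite -mulr_sumr big_split /= -mulr_sumr N; field.
Qed.

Let div_viscous x :
  \sum_i partial i (fun x => - mu * (\sum_j V j x * partial i (V j) x)) x =
  - mu * (\sum_j V j x * \sum_i partial i (partial i (V j)) x) - mu * dissipation x.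
Proof.
rewrite -mulNr -mulrDr.
have Ei i : partial i (fun x => - mu * (\sum_j V j x * partial i (V j) x)) x =
    - mu * (\sum_j V j x * partial i (partial i (V j)) x + \sum_j partial i (V j) x ^+ 2).
  rewrite (partialZ _ _ _ (Cvisc i)) (partial_sum _ _ (fun j => C1M (CV j) (CdV i j))).
  rewrite -big_split; congr (_ * _); apply: eq_bigr => j _.
  exact: (partialM _ _ (CV j) (CdV i j)).
under eq_bigr do rewrite Ei.
rewrite -mulr_sumr big_split /= exchange_big /=; congr (_ * (_ + _)).
by apply: eq_bigr => j _; rewrite mulr_sumr.
Qed.

Let div_dilatation x :
  \sum_i partial i (fun x => - a * (V i x * D x)) x =
  - a * (\sum_j V j x * partial j D x) - a * D x ^+ 2.
Proof.
rewrite -mulNr -mulrDr.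
under eq_bigr => i _ do rewrite (partialZ _ _ _ (CVD i)) (partialM _ _ (CV i) CD).
by rewrite -mulr_sumr big_split /= -mulr_sumr.
Qed.

(** Symmetry of second derivatives produces the same work term as in [div_dilatation], but with a
    cross term in place of [D x ^+ 2]. *)
Let div_convective x :
  \sum_i partial i (fun x => b * (\sum_j V j x * partial j (V i) x)) x =
  b * (\sum_j V j x * partial j D x)
  + b * \sum_i \sum_j partial i (V j) x * partial j (V i) x.
Proof.
rewrite -mulrDr.
have Ei i : partial i (fun x => b * (\sum_j V j x * partial j (V i) x)) x =
    b * (\sum_j V j x * partial j (partial i (V i)) x
         + \sum_j partial i (V j) x * partial j (V i) x).
  rewrite (partialZ _ _ _ (Cconv i)) (partial_sum _ _ (fun j => C1M (CV j) (CdV j i))).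
  rewrite -big_split; congr (_ * _); apply: eq_bigr => j _.
  rewrite (partialM _ _ (CV j) (CdV j i)) (partial_comm x (CV i) (CdV j i) (CdV i i)).
  by congr (_ + _); exact: mulrC.
under eq_bigr do rewrite Ei.
rewrite -mulr_sumr big_split /= exchange_big /=; congr (_ * (_ + _)).
by apply: eq_bigr => j _; rewrite (partial_sum _ _ (fun i => CdV i i)) mulr_sumr.
Qed.

Lemma div_energy_flux x : \sum_i partial i (energy_flux i) x =
  - (mu * dissipation x + a * D x ^+ 2
     - b * \sum_i \sum_j partial i (V j) x * partial j (V i) x).
Proof.
have Ei i : partial i (energy_flux i) x =
    partial i (fun x => 2^-1 * (rho x * V i x * \sum_j V j x * V j x)) x
    + partial i (fun x => gamma / (gamma - 1) * (P x * V i x)) x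
    + partial i (fun x => - mu * (\sum_j V j x * partial i (V j) x)) x
    + partial i (fun x => - a * (V i x * D x)) x
    + partial i (fun x => b * (\sum_j V j x * partial j (V i) x)) x.
  exact: (flux_sum i).2.
under eq_bigr do rewrite Ei.
rewrite !big_split /=.
apply: etrans (congr2 +%R (congr2 +%R (congr2 +%R (congr2 +%R (div_kinetic x)
  (div_pressure x)) (div_viscous x)) (div_dilatation x)) (div_convective x)) _.
(* The momentum equation tested with [v]; what survives afterwards is quadratic in the gradient of
   [v]. *)
have -> : \sum_j V j x * \sum_i partial i (fun y => rho y * V i y * V j y) x =
    - (\sum_j V j x * partial j P x)
    + mu * (\sum_j V j x * \sum_i partial i (partial i (V j)) x)
    + (a - b) * (\sum_j V j x * partial j D x).
  rewrite -sumrN !mulr_sumr -!big_split /=; apply: eq_bigr => j _.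
  by rewrite (momentum j x); ring.
set s1 := \sum_i _ * partial i P x; set s2 := \sum_i _ * partial i D x.
set s3 := \sum_i _ * \sum_j _; set s4 := \sum_i \sum_j _; set s5 := D x.
by ring.
Qed.

(** [dissipation] is symmetrized in [i] and [j], then 2 p q <= p^2 + q^2. The constant 1 makes
    [b < mu] enough for coercivity; for negative mu + lambda this is lambda + 2 mu > 0. *)
Lemma cross_le_dissipation x :
  \sum_i \sum_j partial i (V j) x * partial j (V i) x <= dissipation x.
Proof.
have E : dissipation x =
    \sum_i \sum_j 2^-1 * (partial i (V j) x ^+ 2 + partial j (V i) x ^+ 2).
  under [RHS]eq_bigr do rewrite -mulr_sumr big_split /=.
  rewrite -mulr_sumr big_split /= [X in _ * (_ + X)]exchange_big /= -/(dissipation x).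
  by field.
rewrite E; apply: ler_sum => i _; apply: ler_sum => j _.
set p := partial i _ x; set q := partial j _ x.
by rewrite -subr_ge0 (_ : _ - _ = 2^-1 * (p - q) ^+ 2); [rewrite mulr_ge0 ?sqr_ge0|field].
Qed.

Lemma dissipation_ge0 x : 0 <= dissipation x.
Proof. by apply: sumr_ge0 => i _; apply: sumr_ge0 => j _; exact: sqr_ge0. Qed.

Lemma cts_dissipation : continuous dissipation.
Proof.
apply: cts_sum => i; apply: cts_sum => j.
have [c _] := CdV i j.
by apply: (@ctsM R _ (partial i (V j)) (partial i (V j))).
Qed.

Lemma le_partial_dissipation i j x : `|partial i (V j) x| <= Num.sqrt (dissipation x).
Proof.
rewrite -sqrtr_sqr ler_sqrt ?dissipation_ge0 //.
rewrite /dissipation (bigD1 i) //= (bigD1 j) //= -addrA lerDl addr_ge0 //.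
  by apply: sumr_ge0 => *; exact: sqr_ge0.
by apply: sumr_ge0 => *; apply: sumr_ge0 => *; exact: sqr_ge0.
Qed.

Lemma sum_comp_sqr x : \sum_j V j x * V j x = enorm (v x) ^+ 2.
Proof. by rewrite sqr_sqrtr // sumr_ge0 // => j _; exact: sqr_ge0. Qed.

Lemma le_comp_enorm j x : `|V j x| <= enorm (v x).
Proof.
rewrite -sqrtr_sqr ler_sqrt; last by apply: sumr_ge0 => *; exact: sqr_ge0.
by rewrite (bigD1 j) //= lerDl; apply: sumr_ge0 => *; exact: sqr_ge0.
Qed.

Lemma cts_enorm : continuous (fun x => enorm (v x)).
Proof.
move=> x; apply: (@continuous_comp _ _ _ (fun x => \sum_j v x ord0 j ^+ 2) Num.sqrt).
  move: x; apply: cts_sum => j; have [c _] := CV j.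
  exact: (@ctsM R _ (V j) (V j)).
exact: sqrt_continuous.
Qed.

(** Each of the five terms is a constant times one of |v|, |v|^3 and |v| |grad v|; [rho x <= M]
    controls the kinetic and the pressure term, and the constants are added up. *)
Lemma energy_flux_bound M i x : (forall x, rho x <= M) -> 0 < A -> 0 <= mu ->
  0 <= a -> 0 <= b ->
  `|energy_flux i x| <=
  (2^-1 * M + gamma / (gamma - 1) * (A * M `^ gamma) + (mu + a + b) * d%:R) *
  (enorm (v x) + enorm (v x) ^+ 3 + enorm (v x) * Num.sqrt (dissipation x)).
Proof.
move=> rM A0 mu0 a0 b0.
have M0 : 0 <= M by apply: le_trans (rM x).
have c0 : 0 <= gamma / (gamma - 1).
  by rewrite divr_ge0 ?(ltW gamma_gt0) // subr_ge0 ltW.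
set u := enorm (v x); set w := Num.sqrt _; set c := gamma / _ in c0 *.
have u0 : 0 <= u by exact: sqrtr_ge0.
have w0 : 0 <= w by exact: sqrtr_ge0.
have K0 : 0 <= A * M `^ gamma by rewrite mulr_ge0 ?powR_ge0 // ltW.
have sumb (f : 'I_d -> R) (B : R) : (forall j, `|f j| <= B) -> `|\sum_j f j| <= d%:R * B.
  move=> fB; apply: le_trans (ler_norm_sum _ _ _) _.
  apply: (@le_trans _ _ (\sum_(j < d) B)); first exact: ler_sum.
  by rewrite sumr_const card_ord mulr_natl.
have t1 : `|2^-1 * (rho x * V i x * \sum_j V j x * V j x)| <= 2^-1 * M * u ^+ 3.
  rewrite sum_comp_sqr -/u !normrM (ger0_norm (rho0 x)) -normrM -expr2.
  rewrite (ger0_norm (sqr_ge0 u)).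
  rewrite ger0_norm ?invr_ge0 // -[leRHS]mulrA ler_wpM2l ?invr_ge0 //.
  rewrite -mulrA ler_pM ?mulr_ge0 ?sqr_ge0 // exprS ler_wpM2r ?sqr_ge0 //.
  exact: le_comp_enorm.
have t2 : `|c * (P x * V i x)| <= c * (A * M `^ gamma) * u.
  rewrite [`|c * _|]normrM (ger0_norm c0) !normrM (gtr0_norm A0).
  rewrite (ger0_norm (powR_ge0 _ _)).
  rewrite -[leRHS]mulrA ler_wpM2l // ler_pM ?mulr_ge0 ?powR_ge0 ?(ltW A0) ?le_comp_enorm //.
  rewrite ler_wpM2l ?(ltW A0) // ge0_ler_powR ?nnegrE ?(ltW gamma_gt0) //.
have uw i' j j' : `|V j x * partial i' (V j') x| <= u * w.
  by rewrite normrM ler_pM ?le_comp_enorm ?le_partial_dissipation.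
have t3 : `|- mu * (\sum_j V j x * partial i (V j) x)| <= mu * (d%:R * (u * w)).
  by rewrite normrM normrN (ger0_norm mu0) ler_wpM2l // sumb.
have t4 : `|- a * (V i x * D x)| <= a * (d%:R * (u * w)).
  by rewrite normrM normrN (ger0_norm a0) ler_wpM2l // mulr_sumr sumb.
have t5 : `|b * (\sum_j V j x * partial j (V i) x)| <= b * (d%:R * (u * w)).
  by rewrite normrM (ger0_norm b0) ler_wpM2l // sumb.
have tri (y1 y2 y3 y4 y5 z1 z2 z3 z4 z5 : R) : `|y1| <= z1 -> `|y2| <= z2 ->
    `|y3| <= z3 -> `|y4| <= z4 -> `|y5| <= z5 ->
    `|y1 + y2 + y3 + y4 + y5| <= z1 + z2 + z3 + z4 + z5.
  by move=> *; do 4!(apply: le_trans (ler_normD _ _) _; apply: lerD => //).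
apply: le_trans (tri _ _ _ _ _ _ _ _ _ _ t1 t2 t3 t4 t5) _.
have u3 : 0 <= u ^+ 3 by rewrite exprn_ge0.
have uw0 : 0 <= u * w by rewrite mulr_ge0.
rewrite -subr_ge0.
have -> : forall X : R, (2^-1 * M + X + (mu + a + b) * d%:R) * (u + u ^+ 3 + u * w)
  - (2^-1 * M * u ^+ 3 + X * u + mu * (d%:R * (u * w)) + a * (d%:R * (u * w)) + b * (d%:R * (u * w)))
  = 2^-1 * M * (u + u * w) + X * (u ^+ 3 + u * w) + (mu + a + b) * d%:R * (u + u ^+ 3).
  by move=> X; ring.
have mab0 : 0 <= mu + a + b by rewrite !addr_ge0.
by apply: addr_ge0; [apply: addr_ge0|];
   apply: mulr_ge0; rewrite ?addr_ge0 // mulr_ge0 // invr_ge0.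
Qed.

End energy_flux.

(** * Conclusion for the velocity and the density *)

Lemma enorm_eq0 (R : realType) (d : nat) (w : 'rV[R]_d) : enorm w = 0 -> w = 0.
Proof.
move=> w0; apply/rowP => j; rewrite mxE; apply/eqP; rewrite -normr_le0 -w0.
rewrite -sqrtr_sqr ler_sqrt; last by apply: sumr_ge0 => *; exact: sqr_ge0.
by rewrite (bigD1 j) //= lerDl; apply: sumr_ge0 => *; exact: sqr_ge0.
Qed.

Lemma Lp_finite_cst (R : realType) (d : nat) (p : R) (w : 'rV[R]_d) :
  (0 < d)%N -> Lp_finite p (fun _ : 'rV[R]_d => w) -> w = 0.
Proof.
case: d w => // d w _ Lp; apply: enorm_eq0; apply/eqP/negPn/negP => w0.
have e0 : 0 < enorm w by rewrite lt_neqAle eq_sym w0 sqrtr_ge0.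
move: Lp; rewrite /Lp_finite /Rd_integral iter_integral_cst ?ltxx //.
by rewrite lte_fin powR_gt0.
Qed.

Theorem theorem1p2 (R : realType) (d : nat) (mu lambda A gamma : R)
  (rho : 'rV[R]_d -> R) (v : 'rV[R]_d -> 'rV[R]_d) :
  (2 <= d)%N ->
  0 < mu -> 0 < lambda + 2 * mu -> 0 < A -> 1 < gamma ->
  (forall x, 0 <= rho x) ->
  smooth rho ->
  (forall j, smooth (vcomp v j)) ->
  (* continuity equation  div (rho v) = 0 *)
  (forall x, \sum_(i < d) partial i (fun y => rho y * vcomp v i y) x = 0) ->
  (* momentum equation, with P = A rho^gamma *)
  (forall (j : 'I_d) x,
     \sum_(i < d) partial i (fun y => rho y * vcomp v i y * vcomp v j y) x
     = - partial j (fun y => A * rho y `^ gamma) x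
       + mu * (\sum_(i < d) partial i (partial i (vcomp v j)) x)
       + (mu + lambda) * partial j (fun y => \sum_(i < d) partial i (vcomp v i) y) x) ->
  Linf_bounded rho ->
  Lp_finite (d%:R / (d%:R - 1)) v ->
  Lp_finite (3 * d%:R / (d%:R - 1)) v ->
  (forall x, v x = 0) /\ (exists c : R, forall x, rho x = c).
Proof.
move=> d2 mu0 lm0 A0 g1 rho0 srho sv cont mom [M rhoM] Lp L3p.
have d0 : (0 < d)%N := ltnW d2.
have rM x : rho x <= M by apply: le_trans (rhoM x); exact: ler_norm.
(* Splitting mu + lambda = a - b with 0 <= b < mu makes the dissipation coercive
   even when mu + lambda < 0. *)
have [a [b [ab a0 b0 bmu]]] : exists a b, [/\ mu + lambda = a - b, 0 <= a, 0 <= b & b < mu].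
  have [h|h] := leP 0 (mu + lambda).
    by exists (mu + lambda), 0; split; rewrite ?subr0.
  by exists 0, (- (mu + lambda)); split; lra.
rewrite ab in mom.
have W0 x : dissipation v x = 0.
  have gg0 : 0 <= gamma / (gamma - 1) by rewrite divr_ge0 ?subr_ge0; lra.
  have M0 : 0 <= M by apply: le_trans (rM 0).
  apply: (@liouville_flux R d (energy_flux mu A gamma a b rho v) (dissipation v)
    (fun x => enorm (v x)) (mu - b)
    (2^-1 * M + gamma / (gamma - 1) * (A * M `^ gamma) + (mu + a + b) * d%:R)) => //.
  - by move=> i; exact: C1_energy_flux.
  - exact: cts_dissipation.
  - by move=> y; exact: dissipation_ge0.
  - exact: cts_enorm.
  - by move=> y; exact: sqrtr_ge0.
  - by rewrite subr_gt0.
  - have AM : 0 <= A * M `^ gamma by rewrite mulr_ge0 ?powR_ge0 // ltW.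
    have mab : 0 <= mu + a + b by rewrite !addr_ge0 // ltW.
    by apply: addr_ge0; [apply: addr_ge0|]; rewrite mulr_ge0 ?invr_ge0.
  (* The squared divergence has the good sign, and the cross term costs at most [b] times the
     dissipation, leaving [mu - b]. *)
  - move=> y; rewrite (div_energy_flux g1 rho0 srho sv cont mom).
    have := ler_wpM2l b0 (cross_le_dissipation v y).
    have := mulr_ge0 a0 (sqr_ge0 (\sum_i partial i (vcomp v i) y)).
    set T := \sum_i \sum_j _; set W := dissipation v y; set S := a * _.
    have -> : - (mu - b) * W = b * W - mu * W by ring.
    lra.
  - by move=> i y; apply: energy_flux_bound => //; exact: ltW.
  - by move: L3p; rewrite -(mulrA 3).
have dV0 i j x : partial i (vcomp v j) x = 0.
  apply/eqP; rewrite -normr_le0; apply: le_trans (le_partial_dissipation v i j x) _.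
  by rewrite W0 sqrtr0.
have vc : v = fun=> v 0.
  apply/funext => x; apply/rowP => j.
  exact: (zero_partials_cst (smooth_C1 (sv j)) (fun i => dV0 i j)).
have v0 : v 0 = 0 by apply: (Lp_finite_cst d0); rewrite -vc; exact: Lp.
have {}vc x : v x = 0 by rewrite vc.
split=> //.
have Vz j : vcomp v j = fun=> 0 by apply/funext => x; rewrite /vcomp vc mxE.
have [CP _] := C1_partial_pressure A g1 rho0 srho.
have dP0 j x : partial j (fun y => A * rho y `^ gamma) x = 0.
  have := mom j x.
  have -> : (fun y => \sum_i partial i (vcomp v i) y) = fun=> 0.
    by apply/funext => y; apply: big1 => i _; exact: dV0.
  rewrite [LHS]big1; last first.
    move=> i _; rewrite (_ : (fun y => _) = fun=> 0) ?partial_cst //.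
    by apply/funext => y; rewrite Vz mulr0 mul0r.
  rewrite [X in mu * X]big1; last first.
    move=> i _; rewrite (_ : partial i (vcomp v j) = fun=> 0) ?partial_cst //.
    by apply/funext => y; exact: dV0.
  by rewrite partial_cst !mulr0 !addr0 => /eqP; rewrite eq_sym oppr_eq0 => /eqP.
exists (rho 0) => x.
have := zero_partials_cst CP dP0 x.
move=> /(mulfI (lt0r_neq0 A0)).
(* The density is recovered from the pressure by injectivity of the power on nonnegative reals,
   vacuum included. *)
by apply: powR_injective; rewrite ?nnegrE //; apply: lt_trans g1.
Qed.
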